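(* Let $\mathcal G$ be a metric graph and let $\mathfrak C(\mathcal G)$ be the set of its topological ends. Then $$H^1_0(\mathcal G)=\{f\in H^1(\mathcal G)\,:\, f(\gamma)=0\ \text{ for all }\gamma\in\mathfrak C(\mathcal G)\}.$$
   Context: Metric graphs. Let $\mathcal G_d=(\mathcal V,\mathcal E)$ be an unoriented graph with countably infinite vertex and edge sets which is locally finite (each vertex $v$ has finite degree), connected and simple (no loops or multiple edges). Given edge lengths $|e|\in(0,\infty)$, $e\in\mathcal E$, the metric graph $\mathcal G=(\mathcal G_d,|\cdot|)$ is the topological space obtained by identifying each edge $e$ with the interval $[0,|e|]$ and gluing together endpoints corresponding to the same vertex. It carries the natural path metric and the Lebesgue measure $dx$ on its edges. $\mathcal E_v$ is the set of edges incident to $v$; a function $f$ on $\mathcal G$ has edge components $f_e=f|_e$; $f_e'(v)$ denotes the derivative of $f_e$ at the vertex $v$ of $e$ taken in the direction pointing from $v$ into $e$. $L^2(\mathcal G)=\bigoplus_{e}L^2(e)$. Ends. Consider sequences $(U_n)_{n\ge0}$ of non-empty open connected subsets of $\mathcal G$ with compact boundaries, $U_{n+1}\subseteq U_n$ and $\bigcap_n\overline{U_n}=\emptyset$. Two such sequences $(U_n),(U_n')$ are equivalent if for every $n$ there are $j,k$ with $U_n\supseteq U_j'$ and $U_n'\supseteq U_k$. Equivalence classes are called topological ends of $\mathcal G$; the set of them is $\mathfrak C(\mathcal G)$. Boundary values. A ray is a sequence $(v_n)_{n\ge0}$ of distinct vertices with $v_n\sim v_{n+1}$ for all $n$; two rays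 are equivalent if there is a third ray containing infinitely many vertices of both; an equivalence class of rays is a graph end. For each topological end $\gamma$ there is a unique graph end $\omega_\gamma$ such that for every sequence $(U_n)$ representing $\gamma$ each $U_n$ contains a ray from $\omega_\gamma$, and $\gamma\mapsto\omega_\gamma$ is a bijection from topological ends to graph ends. For $f\in H^1(\mathcal G)$ one sets $f(\gamma):=\lim_{n\to\infty}f(v_n)$ for any ray $(v_n)\in\omega_\gamma$ (the limit exists and does not depend on the ray). Sobolev spaces. $H^1(\mathcal G)$ is the space of continuous $f\in L^2(\mathcal G)$ with $f_e\in H^1(e)$ for all $e$ and $\|f'\|_{L^2(\mathcal G)}^2=\sum_e\|f_e'\|^2_{L^2(e)}<\infty$, with norm $\|f\|_{H^1}^2=\|f\|_{L^2}^2+\|f'\|_{L^2}^2$. $H^1_0(\mathcal G)$ is the closure in $H^1(\mathcal G)$ of the set of $f\in L^2(\mathcal G)$ that are non-zero only on finitely many edges, satisfy $f_e\in H^2(e)$ for all $e$, and satisfy at every vertex $v$ the Kirchhoff conditions: $f$ is continuous at $v$ and $\sum_{e\in\mathcal E_v}f_e'(v)=0$. *)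

(* Defs.v *)
From HB Require Import structures.
From mathcomp Require Import all_boot all_order all_algebra.
From mathcomp Require Import all_classical all_reals all_analysis.
From mathcomp Require Import complex.

Set Implicit Arguments.
Unset Strict Implicit.
Unset Printing Implicit Defensive.

Import Order.TTheory GRing.Theory Num.Theory numFieldNormedType.Exports.

Local Open Scope classical_set_scope.
Local Open Scope ring_scope.
Local Open Scope complex_scope.

(* Each edge comes with an arbitrary orientation, which only serves to choose
   one of the two identifications of the edge with [0, len]; the graph itself
   is unoriented: see [mg_adj] and [no_multi]. *)
Record metric_graph (R : realType) := MetricGraph {
  vert : countType ;
  edge : countType ;
  src : edge -> vert ;
  tgt : edge -> vert ;
  len : edge -> R ;
  mg_adj : rel vert := fun u v => `[< exists e : edge,
    (src e = u /\ tgt e = v) \/ (src e = v /\ tgt e = u) >] ;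
  vert_infinite : infinite_set [set: vert] ;
  edge_infinite : infinite_set [set: edge] ;
  len_gt0 : forall e, 0 < len e ;
  no_loop : forall e, src e <> tgt e ;
  no_multi : forall e e',
    (src e = src e' /\ tgt e = tgt e') \/ (src e = tgt e' /\ tgt e = src e') ->
    e = e' ;
  locally_finite : forall v, finite_set [set e | src e = v \/ tgt e = v] ;
  graph_connected : forall u v, exists p : seq vert,
    path mg_adj u p /\ last u p = v
}.

Arguments src {R G} e : rename.
Arguments tgt {R G} e : rename.
Arguments len {R G} e : rename.
Arguments mg_adj {R G} : rename.

Section Space.
Context {R : realType} (G : metric_graph R).

(* The underlying set of the metric graph: gluing endpoints leaves one point
   per vertex and the open interval ]0, len e[ for each edge e. *)
Inductive mg_point : Type :=
| Vertex of vert G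
| Inner (e : edge G) (t : R) of 0 < t < len e.

(* The gluing map [0, len e] -> G of the edge e, made total on R by letting it
   be constant on t <= 0 and on t >= len e. *)
Definition edge_map (e : edge G) (t : R) : mg_point :=
  match @idP (0 < t < len e) with
  | ReflectT t_in => Inner t_in
  | ReflectF _ => Vertex (if t <= 0 then src e else tgt e)
  end.

HB.instance Definition _ := gen_eqMixin mg_point.
HB.instance Definition _ := gen_choiceMixin mg_point.

(* The quotient topology. Clamping R -> [0, len e] is a quotient map, so a
   subset of [0, len e] is relatively open iff its preimage in R is open. *)
Definition mg_open (U : set mg_point) : Prop :=
  forall e : edge G, open (edge_map e @^-1` U).

Lemma mg_openT : mg_open setT.
Proof. by move=> e; rewrite preimage_setT; exact: openT. Qed.

Lemma mg_openI (U W : set mg_point) :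
  mg_open U -> mg_open W -> mg_open (U `&` W).
Proof. by move=> oU oW e; rewrite preimage_setI; exact: openI. Qed.

Lemma mg_openU (I : Type) (U : I -> set mg_point) :
  (forall i, mg_open (U i)) -> mg_open (\bigcup_i U i).
Proof. by move=> oU e; rewrite preimage_bigcup; apply: bigcup_open => i _; exact: oU. Qed.

HB.instance Definition _ :=
  isOpenTopological.Build mg_point mg_openT mg_openI mg_openU.

End Space.

Arguments Vertex {R G} v.
Arguments Inner {R G} e {t}.
Arguments edge_map {R G} e t.

Section Ends.
Context {R : realType} (G : metric_graph R).

Definition boundary (T : topologicalType) (A : set T) : set T :=
  closure A `\` A°.

Definition end_sequence (U : nat -> set (mg_point G)) : Prop :=
  [/\ forall n, [/\ U n !=set0, open (U n), connected (U n) &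
                    compact (boundary (U n))],
      forall n, U n.+1 `<=` U n &
      \bigcap_n closure (U n) = set0].

Definition end_equiv (U U' : nat -> set (mg_point G)) : Prop :=
  forall n, exists j k, U' j `<=` U n /\ U k `<=` U' n.

Definition topological_ends : set (set (nat -> set (mg_point G))) :=
  [set g | exists U, end_sequence U /\
     g = [set U' | end_sequence U' /\ end_equiv U U']].

Definition ray (v : nat -> vert G) : Prop :=
  injective v /\ forall n, mg_adj (v n) (v n.+1).

Definition ray_equiv (v v' : nat -> vert G) : Prop :=
  exists w, [/\ ray w, infinite_set (range w `&` range v) &
                infinite_set (range w `&` range v')].

Definition graph_ends : set (set (nat -> vert G)) :=
  [set o | exists v, ray v /\ o = [set v' | ray v' /\ ray_equiv v v']].

(* [end_corresp g o] : o is the graph end omega_g of the topological end g *)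
Definition end_corresp (g : set (nat -> set (mg_point G)))
    (o : set (nat -> vert G)) : Prop :=
  graph_ends o /\
  forall U, g U -> forall n, exists2 v, o v & forall k, U n (Vertex (v k)).

(* f(g) = l. Stating this as a relation, rather than with the total operator
   [lim], makes the existence of omega_g and of the limits part of the claim. *)
Definition boundary_value (f : mg_point G -> R[i]^o)
    (g : set (nat -> set (mg_point G))) (l : R[i]^o) : Prop :=
  exists2 o, end_corresp g o &
    forall v, o v -> (fun n => f (Vertex (v n))) @ \oo --> l.

End Ends.

Section Interval.
Context {R : realType}.
Local Notation mu := (@lebesgue_measure R).

Definition abs2 (z : R[i]) : R := complex.Re z ^+ 2 + complex.Im z ^+ 2.

Definition cintegral (D : set R) (u : R -> R[i]) : R[i] :=
  Rintegral mu D (fun x => complex.Re (u x)) +i*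
  Rintegral mu D (fun x => complex.Im (u x)).

Definition L2sq (L : R) (u : R -> R[i]) : \bar R :=
  (\int[mu]_(x in `[0%R, L]) (abs2 (u x))%:E)%E.

Definition L2_interval (L : R) (u : R -> R[i]) : Prop :=
  [/\ measurable_fun `[0, L] (fun x => complex.Re (u x)),
      measurable_fun `[0, L] (fun x => complex.Im (u x)) &
      (L2sq L u < +oo)%E].

(* u is absolutely continuous on [0, L] with derivative g in L^2(0, L) *)
Definition is_wderiv (L : R) (u g : R -> R[i]) : Prop :=
  L2_interval L g /\
  forall x, x \in `[0, L] -> u x = u 0 + cintegral `[0, x] g.

Definition H1_interval (L : R) (u : R -> R[i]) : Prop :=
  L2_interval L u /\ exists g, is_wderiv L u g.

(* An L^2 representative of u'; it is unique up to null sets when u is in H^1,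
   and only its L^2 norm is used. *)
Definition wderiv (L : R) (u : R -> R[i]) : R -> R[i] :=
  xget (fun=> 0) [set g | is_wderiv L u g].

Definition H2_interval (L : R) (u : R -> R[i]) : Prop :=
  H1_interval L u /\ exists g, is_wderiv L u g /\ H1_interval L g.

End Interval.

Section Sobolev.
Context {R : realType} (G : metric_graph R).
Implicit Type f : mg_point G -> R[i]^o.

Definition edge_fun f (e : edge G) : R -> R[i]^o := fun t => f (edge_map e t).

Definition L2norm_sq f : \bar R :=
  \esum_(e in [set: edge G]) L2sq (len e) (edge_fun f e).

Definition L2norm_deriv_sq f : \bar R :=
  \esum_(e in [set: edge G]) L2sq (len e) (wderiv (len e) (edge_fun f e)).

Definition H1norm_sq f : \bar R := (L2norm_sq f + L2norm_deriv_sq f)%E.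

Definition L2_graph f : Prop :=
  (forall e, L2_interval (len e) (edge_fun f e)) /\ (L2norm_sq f < +oo)%E.

Definition H1 : set (mg_point G -> R[i]^o) :=
  [set f | [/\ continuous f, L2_graph f,
               forall e, H1_interval (len e) (edge_fun f e) &
               (L2norm_deriv_sq f < +oo)%E]].

(* f_e'(v), for v an endpoint of e *)
Definition outer_deriv f (v : vert G) (e : edge G) : R[i]^o :=
  if v == src e
  then lim ((fun t : R =>
         (edge_fun f e t - edge_fun f e 0) / t%:C) @ (0 : R)^'+)
  else lim ((fun t : R =>
         (edge_fun f e (len e - t) - edge_fun f e (len e)) / t%:C) @ (0 : R)^'+).

Definition kirchhoff f (v : vert G) : Prop :=
  {for Vertex v, continuous f} /\
  \sum_(e \in [set e | src e = v \/ tgt e = v]) outer_deriv f v e = 0.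

Definition H2_finite_kirchhoff : set (mg_point G -> R[i]^o) :=
  [set f | [/\ L2_graph f,
    finite_set [set e | exists2 t, t \in `[0, len e] & edge_fun f e t != 0],
    forall e, H2_interval (len e) (edge_fun f e) &
    forall v, kirchhoff f v]].

Definition H1_0 : set (mg_point G -> R[i]^o) :=
  [set f | H1 f /\ forall eps : R, 0 < eps ->
    exists2 g, H2_finite_kirchhoff g & (H1norm_sq (f \- g)%R < (eps ^+ 2)%:E)%E].

End Sobolev.

Arguments topological_ends {R} G.
Arguments H1 {R} G.
Arguments H1_0 {R} G.

(* Main.v *)
(** For [f] in H^1 the derivative of |f|^2 is 2 Re(conj(f) f'), so |f|^2 changes
    along a path by at most the H^1 energy of [f] on the edges of that path.
    Hence vertex values are bounded by the H^1 norm. A function with finite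
    support vanishes eventually along every ray, so elements of H^1_0 tend to 0
    along every ray, whatever its end.

    Conversely, let [f] vanish at all ends. If |f|^2 >= d at infinitely many
    vertices, then removing more and more edges leaves a nested sequence of
    components, each containing infinitely many of these vertices. Their open
    stars represent a topological end, along which [f] tends to 0, while the
    oscillation of |f|^2 on the components is bounded by the energy of the
    remaining edges, which tends to 0: a contradiction. Now shrink the vertex
    values of [f] towards 0 by a small amount; only finitely many stay nonzero.
    On finitely many edges carrying almost all the energy, [f] is approximated
    by H^2 functions with the shrunk boundary values. On each other edge a
    function with these boundary values exists whose energy is at most a
    constant times that of [f]. Taking all derivatives at the vertices to be 0
    makes the Kirchhoff conditions trivial. *)

Require Import Defs.
From mathcomp Require Import all_boot all_order all_algebra.
From mathcomp Require Import all_classical all_reals all_analysis.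
From mathcomp Require Import measurable_realfun complex.
From mathcomp Require Import ring lra.

Set Implicit Arguments.
Unset Strict Implicit.
Unset Printing Implicit Defensive.

Import Order.TTheory GRing.Theory Num.Theory numFieldNormedType.Exports.
Local Open Scope classical_set_scope.
Local Open Scope ring_scope.

(** * Integrals over compact intervals *)

(** The obstacle is that edge lengths may come arbitrarily close to 0: multiplying [f] by a cutoff
    function that descends over short edges may cost a large Dirichlet energy. Therefore only the
    vertex values are altered, and every edge is then filled in separately. The alteration is the
    soft threshold [x - clamp r x], applied to real and imaginary parts. It moves a value by at most
    [r] and increases neither absolute values nor differences. The last two properties give an
    energy bound on each edge whose constant depends neither on its length nor on [r]. Hence the
    finite set of edges can be fixed before [r], and [r] has to be small only relative to those
    edges. Inside an edge, the derivative is approximated in L^2 by a C^1 function with zero end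
    values and the same integral; its antiderivative keeps both vertex values and has zero slopes
    there. A boundary value also presupposes a graph end matching the topological end. Its existence
    is proved by extracting a ray from an end sequence, through a walk that descends the sequence
    and whose loops are then erased. *)

Section RealIntegral.
Context {R : realType}.
Local Notation mu := (@lebesgue_measure R).
Implicit Types (f g u : R -> R) (a b c x y L : R).

Definition integ a b f := mu.-integrable `[a, b] (EFin \o f).

Lemma integ_sub a b a' b' f : integ a b f -> a <= a' -> b' <= b -> integ a' b' f.
Proof.
move=> fi aa bb; apply: integrableS fi => //.
by apply: subset_itv; rewrite bnd_simp.
Qed.

Lemma integ_meas a b f : integ a b f -> measurable_fun `[a, b] f.
Proof. by move=> /integrableP[/measurable_EFinP]. Qed.

Lemma integ_le a b f g : measurable_fun `[a, b] f -> integ a b g ->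
  (forall x, x \in `[a, b] -> `|f x| <= g x) -> integ a b f.
Proof.
move=> mf gi fg; apply: le_integrable gi => //; first exact/measurable_EFinP.
move=> x xab /=; rewrite lee_fin (le_trans (fg x xab))// ler_norm//.
Qed.

Lemma integD a b f g : integ a b f -> integ a b g -> integ a b (fun x => f x + g x).
Proof.
move=> fi gi; rewrite /integ (_ : EFin \o _ = (EFin \o f) \+ (EFin \o g))%E//.
exact: integrableD.
Qed.

Lemma integZ a b f k : integ a b f -> integ a b (fun x => k * f x).
Proof. by move=> fi; exact: (integrableZl _ k fi). Qed.

Lemma integN a b f : integ a b f -> integ a b (fun x => - f x).
Proof. by move=> /(@integZ _ _ _ (-1)); under eq_fun do rewrite mulN1r. Qed.

Lemma integB a b f g : integ a b f -> integ a b g -> integ a b (fun x => f x - g x).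
Proof. by move=> fi /integN gi; exact: integD. Qed.

Lemma integ_cst a b k : integ a b (fun=> k).
Proof.
apply: continuous_compact_integrable; first exact: segment_compact.
by apply: continuous_subspaceT => x; exact: cvg_cst.
Qed.

Lemma integ_cont a b f : continuous f -> integ a b f.
Proof.
move=> cf; apply: continuous_compact_integrable; first exact: segment_compact.
exact: continuous_subspaceT.
Qed.

Lemma integ_norm a b f : integ a b f -> integ a b (fun x => `|f x|).
Proof. by move=> fi; exact: (integrable_norm fi). Qed.

Lemma Rint_split a b c f : a <= b -> b <= c -> integ a c f ->
  \int[mu]_(t in `[a, c]) f t =
  \int[mu]_(t in `[a, b]) f t + \int[mu]_(t in `[b, c]) f t.
Proof.
move=> ab bc fi; apply/eqP; rewrite addrC -subr_eq; apply/eqP.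
rewrite (@Rintegral_itvB _ f (BLeft a) (BRight c) b)// ?bnd_simp//.
rewrite Rintegral_itv_obnd_cbnd//; apply: integrableS fi => //.
by apply: subset_itv; rewrite ?bnd_simp.
Qed.

Lemma Rint_cst a b k : a <= b -> \int[mu]_(t in `[a, b]) k = k * (b - a).
Proof.
rewrite Rintegral_cst//= lebesgue_measure_itv/= lte_fin le_eqVlt.
by move=> /predU1P[->|->//]; rewrite ltxx subrr.
Qed.

Lemma eq_Rint a b f g : (forall x, x \in `[a, b] -> f x = g x) ->
  \int[mu]_(t in `[a, b]) f t = \int[mu]_(t in `[a, b]) g t.
Proof. by move=> fg; apply: eq_Rintegral => x; rewrite inE /=; exact: fg. Qed.

Lemma le_Rint a b f g : integ a b f -> integ a b g ->
  (forall x, x \in `[a, b] -> f x <= g x) ->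
  \int[mu]_(t in `[a, b]) f t <= \int[mu]_(t in `[a, b]) g t.
Proof. by move=> fi gi fg; apply: le_Rintegral. Qed.

Lemma Rint_ge0 a b f : (forall x, x \in `[a, b] -> 0 <= f x) ->
  0 <= \int[mu]_(t in `[a, b]) f t.
Proof. by move=> f0; apply: Rintegral_ge0. Qed.

Lemma Rint_subitv_le a b c d f : integ a d f -> a <= b -> b <= c -> c <= d ->
  (forall x, x \in `[a, d] -> 0 <= f x) ->
  \int[mu]_(t in `[b, c]) f t <= \int[mu]_(t in `[a, d]) f t.
Proof.
move=> fi ab bc cd f0.
rewrite (@Rint_split a b d)//; last exact: le_trans cd.
rewrite (@Rint_split b c d)//; last exact: integ_sub fi _ _.
have h1 : 0 <= \int[mu]_(t in `[a, b]) f t.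
  apply: Rint_ge0 => x; rewrite in_itv/= => /andP[ax xb].
  by apply: f0; rewrite in_itv/= ax (le_trans xb)// (le_trans bc).
have h2 : 0 <= \int[mu]_(t in `[c, d]) f t.
  apply: Rint_ge0 => x; rewrite in_itv/= => /andP[cx xd].
  by apply: f0; rewrite in_itv/= xd andbT (le_trans ab)// (le_trans bc).
by lra.
Qed.

Definition sqint a b g := measurable_fun `[a, b] g /\ integ a b (fun x => g x ^+ 2).

Lemma sqint_sub a b a' b' g : sqint a b g -> a <= a' -> b' <= b -> sqint a' b' g.
Proof.
move=> [mg gi] aa bb; split; last exact: integ_sub gi _ _.
apply: measurable_funS mg => //.
by apply: subset_itv; rewrite bnd_simp.
Qed.

Lemma sqintM a b f g : sqint a b f -> sqint a b g -> integ a b (fun x => f x * g x).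
Proof.
move=> [mf fi] [mg gi]; apply: (@integ_le _ _ _ (fun x => f x ^+ 2 + g x ^+ 2)).
- exact: measurable_funM.
- exact: integD.
- move=> x _; rewrite normrM -(real_normK (num_real (f x))) -(real_normK (num_real (g x))).
  have := sqr_ge0 (`|f x| - `|g x|); have := sqr_ge0 (`|f x| + `|g x|); nra.
Qed.

Lemma sqint_cst a b k : sqint a b (fun=> k).
Proof. by split; [exact: measurable_cst|exact: integ_cst]. Qed.

Lemma sqint_integ a b f : sqint a b f -> integ a b f.
Proof.
by move=> fi; have := sqintM fi (sqint_cst a b 1); under eq_fun do rewrite mulr1.
Qed.

Lemma sqintD a b f g : sqint a b f -> sqint a b g -> sqint a b (fun x => f x + g x).
Proof.
move=> fi gi; split; first by apply: measurable_funD; [case: fi|case: gi].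
have -> : (fun x => (f x + g x) ^+ 2) =
   (fun x => (f x ^+ 2 + g x ^+ 2) + 2 * (f x * g x)) by apply/funext => x; ring.
apply: integD; first by apply: integD; [case: fi|case: gi].
exact/integZ/sqintM.
Qed.

Lemma sqintZ a b f k : sqint a b f -> sqint a b (fun x => k * f x).
Proof.
move=> [mf fi]; split; first by apply: measurable_funM => //; exact: measurable_cst.
by under eq_fun do rewrite exprMn; exact: integZ.
Qed.

Lemma sqintN a b f : sqint a b f -> sqint a b (fun x => - f x).
Proof. by move=> /(@sqintZ _ _ _ (-1)); under eq_fun do rewrite mulN1r. Qed.

Lemma sqintB a b f g : sqint a b f -> sqint a b g -> sqint a b (fun x => f x - g x).
Proof. by move=> fi /sqintN gi; exact: sqintD. Qed.

Lemma sqint_norm a b f : sqint a b f -> sqint a b (fun x => `|f x|).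
Proof.
move=> [mf fi]; split; first exact: measurableT_comp.
by under eq_fun do rewrite real_normK ?num_real//.
Qed.

Lemma sqint_cont a b f : continuous f -> sqint a b f.
Proof.
move=> cf; split; first exact: (integ_meas (integ_cont _ _ cf)).
apply: integ_cont => x; apply: cvgM; exact: cf.
Qed.

Lemma sqint_bounded a b f g k : measurable_fun `[a, b] f -> sqint a b g ->
  (forall x, x \in `[a, b] -> `|f x| <= k * `|g x|) -> sqint a b f.
Proof.
move=> mf [mg gi] fg; split => //.
apply: (@integ_le _ _ _ (fun x => k ^+ 2 * g x ^+ 2)).
- exact: measurable_funX.
- exact: integZ.
- move=> x xab; rewrite normrX -exprMn -(real_normK (num_real (k * g x))).
  rewrite lerXn2r ?nnegrE//.
  rewrite (le_trans (fg x xab))// normrM ler_wpM2r// ler_norm//.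
Qed.

Lemma le_norm_Rint a b f : integ a b f ->
  `|\int[mu]_(t in `[a, b]) f t| <= \int[mu]_(t in `[a, b]) `|f t|.
Proof. by move=> fi; exact: le_normr_Rintegral. Qed.

Lemma RintD a b f g : integ a b f -> integ a b g ->
  \int[mu]_(t in `[a, b]) (f t + g t) =
  \int[mu]_(t in `[a, b]) f t + \int[mu]_(t in `[a, b]) g t.
Proof. by move=> fi gi; exact: RintegralD. Qed.

Lemma RintB a b f g : integ a b f -> integ a b g ->
  \int[mu]_(t in `[a, b]) (f t - g t) =
  \int[mu]_(t in `[a, b]) f t - \int[mu]_(t in `[a, b]) g t.
Proof. by move=> fi gi; exact: RintegralB. Qed.

Lemma RintZ a b f k : integ a b f ->
  \int[mu]_(t in `[a, b]) (k * f t) = k * \int[mu]_(t in `[a, b]) f t.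
Proof. by move=> fi; exact: RintegralZl. Qed.

(** Nonnegativity of the variance: expand the integral of [(f t - c) ^+ 2], where [c] is the mean of
    [f]. *)
Lemma Cauchy_Schwarz_mean a b f : a <= b -> sqint a b f ->
  (\int[mu]_(t in `[a, b]) f t) ^+ 2 <= (b - a) * \int[mu]_(t in `[a, b]) (f t ^+ 2).
Proof.
rewrite le_eqVlt => /predU1P[<- _|ab fi].
  by rewrite set_itv1 !Rintegral_set1 expr0n/= mulr0.
set I := \int[mu]_(t in `[a, b]) f t; set J := \int[mu]_(t in `[a, b]) (f t ^+ 2).
pose c := I / (b - a).
have ba0 : 0 < b - a by rewrite subr_gt0.
have f1 := sqint_integ fi.
have : 0 <= \int[mu]_(t in `[a, b]) (f t - c) ^+ 2 by apply: Rint_ge0 => x _; exact: sqr_ge0.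
have -> : (fun t => (f t - c) ^+ 2) = (fun t => (f t ^+ 2 + (- 2 * c) * f t) + c ^+ 2).
  by apply/funext => t; ring.
rewrite RintD; last exact: integ_cst.
  2: by apply: integD; [case: fi|exact: integZ].
rewrite RintD; [|by case: fi|exact: integZ].
rewrite RintZ// Rint_cst ?(ltW ab)// -/I -/J => h.
have Ic : I = c * (b - a) by rewrite /c divfK// gt_eqF.
by clearbody c I J; move: (mulr_ge0 (ltW ba0) h); rewrite Ic; nra.
Qed.

End RealIntegral.

(** * One-dimensional Sobolev functions *)

Section Sobolev1D.
Context {R : realType}.
Local Notation mu := (@lebesgue_measure R).
Implicit Types (f g h u v : R -> R) (a b c x y L : R).

(** The derivative is explicit data, so that sums, multiples and products of functions come with
    explicit derivatives and no representative has to be chosen. *)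
Definition h1 L u g := sqint 0 L g /\
  forall x, x \in `[0, L] -> u x = u 0 + \int[mu]_(t in `[0, x]) g t.

Lemma h1_incr L u g x y : h1 L u g -> 0 <= x -> x <= y -> y <= L ->
  u y - u x = \int[mu]_(t in `[x, y]) g t.
Proof.
move=> [gi uE] x0 xy yL.
rewrite uE ?in_itv/= ?yL ?(le_trans x0)// [u x]uE ?in_itv/= ?x0 ?(le_trans xy)//.
rewrite (@Rint_split _ 0 x y)//; last exact: integ_sub (sqint_integ gi) _ _.
by ring.
Qed.

Lemma h1_dist L u g x y : h1 L u g -> 0 <= x -> x <= y -> y <= L ->
  `|u y - u x| <= \int[mu]_(t in `[x, y]) `|g t|.
Proof.
move=> ug x0 xy yL; rewrite (h1_incr ug)//; apply: le_norm_Rint.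
by case: ug => gi _; exact: integ_sub (sqint_integ gi) _ _.
Qed.

Lemma h1_meas L u g : 0 <= L -> h1 L u g -> measurable_fun `[0, L] u.
Proof.
move=> L0 [gi uE].
apply: (@eq_measurable_fun _ _ _ _ _ (fun x => u 0 + \int[mu]_(t in `[0, x]) g t)).
  by move=> x; rewrite inE/= => /uE.
apply: measurable_funD; first exact: measurable_cst.
apply: subspace_continuous_measurable_fun => //.
exact: (parameterized_integral_continuous L0 (sqint_integ gi)).
Qed.

Lemma h1_bounded L u g x : h1 L u g -> x \in `[0, L] ->
  `|u x| <= `|u 0| + \int[mu]_(t in `[0, L]) `|g t|.
Proof.
move=> ug; have [gi _] := ug; rewrite in_itv/= => /andP[x0 xL].
rewrite -[u x](subrK (u 0)) addrC (le_trans (ler_normD _ _))// lerD2l.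
rewrite (le_trans (h1_dist ug (lexx 0) x0 xL))//.
exact: (Rint_subitv_le (integ_norm (sqint_integ gi))).
Qed.

Lemma h1_sqint L u g : 0 <= L -> h1 L u g -> sqint 0 L u.
Proof.
move=> L0 ug; have um := h1_meas L0 ug; split => //.
apply: (integ_le _ (integ_cst _ _ ((`|u 0| + \int[mu]_(t in `[0, L]) `|g t|) ^+ 2))).
  exact: measurable_funX.
move=> x xL; rewrite normrX lerXn2r ?nnegrE//; last exact: h1_bounded.
by rewrite (le_trans _ (h1_bounded ug xL)).
Qed.

Lemma h1D L u v g h : h1 L u g -> h1 L v h -> h1 L (fun x => u x + v x) (fun x => g x + h x).
Proof.
move=> [gi uE] [hi vE]; split; first exact: sqintD.
move=> x /[dup]; rewrite {1}in_itv/= => /andP[x0 xL] xI.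
rewrite RintD; [|exact: integ_sub (sqint_integ gi) _ _|exact: integ_sub (sqint_integ hi) _ _].
by rewrite uE// vE//; ring.
Qed.

Lemma h1Z L u g k : h1 L u g -> h1 L (fun x => k * u x) (fun x => k * g x).
Proof.
move=> [gi uE]; split; first exact: sqintZ.
move=> x /[dup]; rewrite {1}in_itv/= => /andP[x0 xL] xI.
rewrite RintZ; last exact: integ_sub (sqint_integ gi) _ _.
by rewrite uE//; ring.
Qed.

Lemma h1B L u v g h : h1 L u g -> h1 L v h -> h1 L (fun x => u x - v x) (fun x => g x - h x).
Proof.
move=> ug /(@h1Z _ _ _ (-1)) vh; have := h1D ug vh.
by under eq_fun do rewrite mulN1r; under [X in h1 _ _ X]eq_fun do rewrite mulN1r.
Qed.

(* Splitting [x, y] at its midpoint halves the right-hand side, hence iterating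
   it kills it. *)
Lemma superlinear_increments_const L (Phi m : R -> R) :
  (forall x y, 0 <= x -> x <= y -> y <= L ->
     `|Phi y - Phi x| <= (y - x) * (m y - m x)) ->
  forall x y, 0 <= x -> x <= y -> y <= L -> Phi y = Phi x.
Proof.
move=> Pm.
have Pn n : forall x y, 0 <= x -> x <= y -> y <= L ->
    `|Phi y - Phi x| * 2 ^+ n <= (y - x) * (m y - m x).
  elim: n => [|n ih] x y x0 xy yL; first by rewrite expr0 mulr1 Pm.
  pose z := (x + y) / 2.
  have xz : x <= z by rewrite /z; lra.
  have zy : z <= y by rewrite /z; lra.
  have h1 := ih x z x0 xz (le_trans zy yL).
  have h2 := ih z y (le_trans x0 xz) zy yL.
  have t : `|Phi y - Phi x| <= `|Phi y - Phi z| + `|Phi z - Phi x|.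
    by rewrite (le_trans _ (ler_normD _ _))// addrA subrK.
  have := ler_wpM2r (exprn_ge0 n.+1 (ler0n R 2)) t.
  move/le_trans; apply; rewrite exprS mulrDl.
  have -> : (y - x) * (m y - m x) = 2 * ((y - z) * (m y - m z) + (z - x) * (m z - m x)).
    by rewrite /z; field.
  by lra.
move=> x y x0 xy yL; apply/eqP; rewrite -subr_eq0 -normr_le0 leNgt; apply/negP => d0.
set d := `|_| in d0.
set B := (y - x) * (m y - m x).
have [n nB] : exists n, B / d < n%:R.
  by exists (Num.truncn (B / d)).+1; exact: Num.Theory.truncnS_gt.
have := Pn n x y x0 xy yL; rewrite -/d -/B leNgt => /negP; apply.
rewrite -ltr_pdivrMl// mulrC (lt_trans nB)//.
by rewrite -natrX ltr_nat ltn_expl.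
Qed.

(** The difference of the two sides has increments of second order, hence is constant. This gives
    the chain rule for the square when the derivative is merely square integrable, without
    differentiating at any point. *)
Lemma h1_sqr L u g x : h1 L u g -> x \in `[0, L] ->
  u x ^+ 2 = u 0 ^+ 2 + \int[mu]_(t in `[0, x]) (2 * (u t * g t)).
Proof.
move=> ug; rewrite in_itv/= => /andP[x0 xL].
have L0 : 0 <= L by exact: le_trans xL.
have [gi _] := ug.
have ui := h1_sqint L0 ug.
have ugi : integ 0 L (fun t => 2 * (u t * g t)) by apply: integZ; exact: sqintM.
pose Phi y := u y ^+ 2 - \int[mu]_(t in `[0, y]) (2 * (u t * g t)).
(* Chosen so that Cauchy-Schwarz bounds twice the squared integral of [|g|] over [[a, b]] by [b - a]
   times the increment of [m]. *)
pose m y := 2 * \int[mu]_(t in `[0, y]) (g t ^+ 2).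
have := @superlinear_increments_const L Phi m _ 0 x (lexx 0) x0 xL.
rewrite /Phi set_itv1 Rintegral_set1 subr0 => <-; first by rewrite subrK.
move=> a b a0 ab bL.
have gab : sqint a b g by exact: sqint_sub gi _ _.
have g1 : integ a b g by exact: sqint_integ.
have u1 : integ a b u by apply: integ_sub (sqint_integ ui) _ _.
have ug1 : integ a b (fun t => 2 * (u t * g t)) by apply: integ_sub ugi _ _.
rewrite (@Rint_split _ 0 a b (fun t => 2 * (u t * g t)))//; last exact: integ_sub ugi _ _.
rewrite /m (@Rint_split _ 0 a b (fun t => g t ^+ 2))//; last first.
  by case: gi => _ gi; exact: integ_sub gi _ _.
set A := \int[mu]_(t in `[a, b]) `|g t|.
have -> : u b ^+ 2 - (\int[mu]_(t in `[0, a]) (2 * (u t * g t)) +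
     \int[mu]_(t in `[a, b]) (2 * (u t * g t))) -
    (u a ^+ 2 - \int[mu]_(t in `[0, a]) (2 * (u t * g t)))
  = (u b + u a) * (u b - u a) - \int[mu]_(t in `[a, b]) (2 * (u t * g t)) by ring.
rewrite (h1_incr ug a0 ab bL) -RintZ// -RintB//; last exact: integZ.
have dom t : t \in `[a, b] ->
    `|(u b + u a) * g t - 2 * (u t * g t)| <= 2 * A * `|g t|.
  rewrite in_itv/= => /andP[at_ tb].
  have -> : (u b + u a) * g t - 2 * (u t * g t) = ((u b - u t) - (u t - u a)) * g t.
    by ring.
  rewrite normrM ler_wpM2r// (le_trans (ler_normB _ _))//.
  have q1 := h1_dist ug (le_trans a0 at_) tb bL.
  have q2 := h1_dist ug a0 at_ (le_trans tb bL).
  have : A = \int[mu]_(t in `[a, t]) `|g t| + \int[mu]_(t in `[t, b]) `|g t|.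
    by apply: Rint_split => //; exact: integ_norm.
  have p1 : 0 <= \int[mu]_(t in `[a, t]) `|g t| by exact: Rint_ge0.
  have p2 : 0 <= \int[mu]_(t in `[t, b]) `|g t| by exact: Rint_ge0.
  by lra.
have i1 : integ a b (fun t => (u b + u a) * g t - 2 * (u t * g t)).
  by apply: integB => //; exact: integZ.
rewrite (le_trans (le_norm_Rint i1))//.
have := le_Rint (integ_norm i1) (integZ (2 * A) (integ_norm g1)) dom.
move=> /le_trans; apply; rewrite RintZ; last exact: integ_norm.
rewrite -/A.
have := Cauchy_Schwarz_mean ab (sqint_norm gab); rewrite -/A.
under eq_Rint do rewrite real_normK ?num_real//.
set J := \int[mu]_(t in `[a, b]) _.
set K := \int[mu]_(t in `[0, a]) _.
by lra.
Qed.

(** Polarization: apply the formula for squares to [u + v], [u] and [v]. *)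
Lemma h1M L u v g h : 0 <= L -> h1 L u g -> h1 L v h ->
  h1 L (fun x => u x * v x) (fun x => u x * h x + v x * g x).
Proof.
move=> L0 ug vh; have [gi _] := ug; have [hi _] := vh.
have ui := h1_sqint L0 ug; have vi := h1_sqint L0 vh.
split.
  have bd w k : h1 L w k -> forall f, sqint 0 L f -> sqint 0 L (fun x => w x * f x).
    move=> wk f fi.
    apply: (@sqint_bounded _ _ _ _ f (`|w 0| + \int[mu]_(t in `[0, L]) `|k t|)) => //.
      by apply: measurable_funM; [exact: h1_meas wk|case: fi].
    by move=> x xL; rewrite normrM ler_wpM2r//; exact: h1_bounded.
  by apply: sqintD; [exact: bd ug _ hi|exact: bd vh _ gi].
move=> x xL; move: (xL); rewrite in_itv/= => /andP[x0 xL'].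
have s := h1_sqr (h1D ug vh) xL; have su := h1_sqr ug xL; have sv := h1_sqr vh xL.
have sub f k : sqint 0 L f -> sqint 0 L k -> integ 0 x (fun t => f t * k t).
  by move=> fi ki; apply: sqintM; [exact: sqint_sub fi _ _|exact: sqint_sub ki _ _].
have e : \int[mu]_(t in `[0, x]) (2 * ((u t + v t) * (g t + h t))) =
   \int[mu]_(t in `[0, x]) (2 * (u t * g t)) + \int[mu]_(t in `[0, x]) (2 * (v t * h t))
   + 2 * \int[mu]_(t in `[0, x]) (u t * h t + v t * g t).
  have i1 : integ 0 x (fun t => 2 * (u t * g t)) by apply/integZ/sub.
  have i2 : integ 0 x (fun t => 2 * (v t * h t)) by apply/integZ/sub.
  have i3 : integ 0 x (fun t => u t * h t + v t * g t) by apply: integD; exact: sub.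
  rewrite -RintZ// -RintD// -RintD//; [|exact: integD|exact: integZ].
  by apply: eq_Rint => t _; ring.
move: s; rewrite e; set A := \int[mu]_(t in _) (_ + _); move: su sv.
set U := \int[mu]_(t in _) _; set V := \int[mu]_(t in _) _ => su sv s.
have -> : u x * v x = ((u x + v x) ^+ 2 - u x ^+ 2 - v x ^+ 2) / 2 by field.
by rewrite s su sv; field.
Qed.

Definition energy L u g :=
  \int[mu]_(t in `[0, L]) (u t ^+ 2) + \int[mu]_(t in `[0, L]) (g t ^+ 2).

Lemma energy_ge0 L u g : 0 <= energy L u g.
Proof. by apply: addr_ge0; apply: Rint_ge0 => x _; exact: sqr_ge0. Qed.

Lemma h1_osc L u g x y : h1 L u g -> x \in `[0, L] -> y \in `[0, L] ->
  `|u y ^+ 2 - u x ^+ 2| <= energy L u g.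
Proof.
wlog xy : x y / x <= y.
  move=> h ug xL yL; have [xy|/ltW yx] := leP x y; first exact: h.
  by rewrite distrC; exact: h.
move=> ug xL yL; move: (xL) (yL); rewrite !in_itv/= => /andP[x0 xL'] /andP[y0 yL'].
have L0 : 0 <= L by exact: le_trans yL'.
have ui := h1_sqint L0 ug; have [gi _] := ug.
have ugi : integ 0 L (fun t => 2 * (u t * g t)) by apply: integZ; exact: sqintM.
rewrite (h1_sqr ug yL) (h1_sqr ug xL) (@Rint_split _ 0 x y)//; last exact: integ_sub ugi _ _.
set a := \int[mu]_(t in _) _; set b := \int[mu]_(t in _) _.
have -> : u 0 ^+ 2 + (a + b) - (u 0 ^+ 2 + a) = b by ring.
have bi : integ x y (fun t => 2 * (u t * g t)) by exact: integ_sub ugi _ _.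
rewrite (le_trans (le_norm_Rint bi))//.
have s1 : integ 0 L (fun t => u t ^+ 2 + g t ^+ 2).
  by apply: integD; [case: ui|case: gi].
rewrite /energy -RintD; [|by case: ui|by case: gi].
apply: (@le_trans _ _ (\int[mu]_(t in `[x, y]) (u t ^+ 2 + g t ^+ 2))).
  apply: le_Rint; [exact: integ_norm|exact: integ_sub s1 _ _|].
  by move=> t _; rewrite ler_norml; have := sqr_ge0 (u t - g t); have := sqr_ge0 (u t + g t); nra.
by apply: (Rint_subitv_le s1) => // t _; rewrite addr_ge0 ?sqr_ge0.
Qed.

(** Average [u x ^+ 2 <= u t ^+ 2 + energy L u g] over [t] in [[0, L]]. *)
Lemma h1_end L u g x : h1 L u g -> x \in `[0, L] ->
  L * u x ^+ 2 <= (1 + L) * energy L u g.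
Proof.
move=> ug xL; move: (xL); rewrite in_itv/= => /andP[x0 xL'].
have L0 : 0 <= L by exact: le_trans xL'.
have ui := h1_sqint L0 ug; have [gi _] := ug.
have : \int[mu]_(t in `[0, L]) (u x ^+ 2) <= \int[mu]_(t in `[0, L]) (u t ^+ 2 + energy L u g).
  apply: le_Rint; [exact: integ_cst|apply: integD; [by case: ui|exact: integ_cst]|].
  by move=> t tL; have := h1_osc ug xL tL; rewrite ler_norml => /andP[]; lra.
rewrite RintD; [|by case: ui|exact: integ_cst].
rewrite !Rint_cst// subr0.
have : 0 <= \int[mu]_(t in `[0, L]) (g t ^+ 2) by apply: Rint_ge0 => t _; exact: sqr_ge0.
rewrite /energy; lra.
Qed.

End Sobolev1D.

(** * Approximation of square integrable functions *)

Section Density.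
Context {R : realType}.
Local Notation mu := (@lebesgue_measure R).
Implicit Types (f g h u v c : R -> R) (a b x y L : R).

(** Pointwise convergence is asked for in the open interval only, since cutoffs that vanish at the
    endpoints do not converge there; the endpoints form a null set. *)
Lemma Rint_dominated_cvg0 a b (f_ : nat -> R -> R) g :
  (forall n, measurable_fun `[a, b] (f_ n)) -> integ a b g ->
  (forall n x, x \in `[a, b] -> `|f_ n x| <= g x) ->
  (forall x, x \in `]a, b[ -> f_ ^~ x @ \oo --> (0 : R)) ->
  (fun n => \int[mu]_(t in `[a, b]) f_ n t) @ \oo --> (0 : R).
Proof.
move=> mf gi fg f0.
have f0' : {ae mu, forall x, `[a, b]%classic x -> (f_ n x)%:E @[n --> \oo] --> 0%E}.
  exists ([set a] `|` [set b]); split; first exact: measurableU.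
    apply: countable_lebesgue_measure0; apply: finite_set_countable.
    by rewrite finite_setU; split; exact: finite_set1.
  move=> x /=; apply: contra_notP => /not_orP[xa xb]; rewrite in_itv/= => /andP[ax xb'].
  apply: cvg_EFin; first by apply: nearW.
  apply: f0; rewrite in_itv/= !lt_neqAle ax xb' !andbT.
  by apply/andP; split; apply/eqP => // e; apply: xa.
have fg' : {ae mu, forall x n, `[a, b]%classic x -> (`|(f_ n x)%:E| <= (g x)%:E)%E}.
  by apply: aeW => x n xab /=; rewrite lee_fin fg.
have [_ _] := @dominated_convergence _ _ _ mu `[a, b]%classic (measurable_itv _)
  (fun n => EFin \o f_ n) (cst 0%E) (EFin \o g)
  (fun n => (measurable_EFinP _ _).2 (mf n)) (measurable_cst _) f0' gi fg'.
by rewrite integral0 => h; apply: (@fine_cvg _ _ _ _ _ 0%R).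
Qed.

Definition sqdist L f g := \int[mu]_(t in `[0, L]) ((f t - g t) ^+ 2).

Lemma sqdist_triangle L f g h : sqint 0 L f -> sqint 0 L g -> sqint 0 L h ->
  sqdist L f h <= 2 * sqdist L f g + 2 * sqdist L g h.
Proof.
move=> fi gi hi.
have [_ fg] := sqintB fi gi; have [_ gh] := sqintB gi hi; have [_ fh] := sqintB fi hi.
rewrite /sqdist -!RintZ// -RintD//; [|exact: integZ|exact: integZ].
apply: le_Rint => //; first by apply: integD; exact: integZ.
by move=> t _; have := sqr_ge0 ((f t - g t) - (g t - h t)); nra.
Qed.

(** The projection onto [[-M, M]]. It truncates functions in the density arguments, and
    [y - clamp M y] is the soft threshold that later shrinks the vertex values. *)
Definition clamp (M y : R) := Num.max (- M) (Num.min M y).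

Lemma clamp_le M y : 0 <= M -> `|clamp M y| <= M.
Proof. by move=> M0; rewrite ler_norml /clamp le_max lexx/= ge_max ge_min lexx/= andbT; lra. Qed.

Lemma clamp_id M y : `|y| <= M -> clamp M y = y.
Proof. by rewrite ler_norml => /andP[h1 h2]; rewrite /clamp min_r// max_r. Qed.

Lemma clampE M y : 0 <= M ->
  clamp M y = if y < - M then - M else if M < y then M else y.
Proof.
move=> M0; rewrite /clamp; case: (ltP M y) => My.
  by rewrite max_r; [case: ifP => //; lra|lra].
by case: (ltP y (- M)) => yM //; lra.
Qed.

Lemma clamp_contract M x y : 0 <= M -> `|clamp M x - clamp M y| <= `|x - y|.
Proof.
move=> M0; have := ler_norm (x - y); have := ler_norm (y - x); rewrite distrC ler_norml.
by rewrite !clampE//; do !case: ifPn; rewrite -?leNgt => *; apply/andP; split; lra.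
Qed.

Lemma clampB_le M y : 0 <= M -> `|y - clamp M y| <= `|y|.
Proof.
move=> M0; have := ler_norm y; have := ler_norm (- y); rewrite normrN ler_norml.
by rewrite !clampE//; do !case: ifPn; rewrite -?leNgt => *; apply/andP; split; lra.
Qed.

Lemma clamp_cont M : 0 <= M -> continuous (clamp M).
Proof.
move=> M0 x; apply/cvgrPdist_lt => e e0; near=> t.
by rewrite (le_lt_trans (clamp_contract _ _ M0))//.
Unshelve. all: by end_near. Qed.

Lemma clamp_meas a b M f : 0 <= M -> measurable_fun `[a, b] f ->
  measurable_fun `[a, b] (fun t => clamp M (f t)).
Proof.
move=> M0 mf; apply: (measurableT_comp _ mf).
exact: continuous_measurable_fun (clamp_cont M0).
Qed.

Lemma dense_bounded L g d : sqint 0 L g -> 0 < d -> exists2 M, 0 <= M &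
  sqdist L g (fun t => clamp M (g t)) < d.
Proof.
move=> gi d0; have [mg g2] := gi.
have : (fun n => sqdist L g (fun t => clamp n%:R (g t))) @ \oo --> (0 : R).
  apply: (Rint_dominated_cvg0 _ g2).
  - by move=> n; apply: measurable_funX; apply: measurable_funB => //; exact: clamp_meas.
  - move=> n x _; rewrite normrX -(real_normK (num_real (g x))) lerXn2r ?nnegrE//.
    by rewrite clampB_le.
  - move=> x _; apply: cvg_near_cst; near=> n.
    by rewrite clamp_id ?subrr ?expr0n//; near: n; exact: nbhs_infty_ger.
move/cvgrPdist_lt => /(_ d d0)[N _ /(_ N (leqnn N))]; rewrite sub0r normrN => h.
by exists N%:R => //; rewrite (le_lt_trans _ h)// ler_norm.
Unshelve. all: by end_near. Qed.

(** L^1 approximation suffices: once the approximant is clamped, both functions are bounded by [M],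
    and the square of their difference is at most [2 * M + 1] times its absolute value. The summand
    1 keeps the divisor positive when [M = 0]. *)
Lemma dense_continuous L f M d : 0 <= L -> measurable_fun `[0, L] f -> 0 <= M ->
  (forall x, `|f x| <= M) -> 0 < d ->
  exists c, [/\ continuous c, forall x, `|c x| <= M & sqdist L f c < d].
Proof.
move=> L0 mf M0 fM d0.
have fi : integ 0 L f by apply: (integ_le mf (integ_cst _ _ M)) => x _; exact: fM.
have [|c_ [cc ci]] := approximation_continuous_integrable (measurable_itv `[0, L]) _ fi.
  by rewrite /= lebesgue_measure_itv/=; case: ifP => _; rewrite ?ltry// -EFinB ltry.
move=> /fine_cvg/cvgrPdist_lt /(_ (d / (2 * M + 1))).
have M1 : 0 < 2 * M + 1 by lra.
move=> /(_ (divr_gt0 d0 M1))[N _ /(_ N (leqnn N))] /=; rewrite sub0r normrN => h.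
pose c := c_ N; exists (fun t => clamp M (c t)); split.
- move=> x; apply: continuous_comp; [exact: cc|exact: (clamp_cont M0)].
- by move=> x; exact: clamp_le.
have ifc : integ 0 L (fun t => f t - c t) by apply: integB => //; exact: ci.
rewrite ltr_pdivlMr// in h; rewrite (le_lt_trans _ h)//.
apply: (@le_trans _ _ (\int[mu]_(t in `[0, L]) ((2 * M + 1) * `|f t - c t|))).
  apply: le_Rint; [|by apply/integZ/integ_norm|].
    apply: (integ_le _ (integ_cst _ _ ((2 * M) ^+ 2))).
      apply: measurable_funX; apply: measurable_funB => //; apply: clamp_meas => //.
      exact: (@integ_meas _ 0 L (c_ N) (ci N)).
    move=> t _; rewrite normrX lerXn2r ?nnegrE//; first by lra.
    by rewrite (le_trans (ler_normB _ _))//; have := fM t; have := clamp_le (c t) M0; lra.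
  move=> t _.
  have e1 : `|f t - clamp M (c t)| <= `|f t - c t|.
    by have := clamp_contract (f t) (c t) M0; rewrite clamp_id.
  have e2 : `|f t - clamp M (c t)| <= 2 * M + 1.
    by rewrite (le_trans (ler_normB _ _))//; have := fM t; have := clamp_le (c t) M0; lra.
  rewrite -(real_normK (num_real (f t - _))) expr2.
  by apply: ler_pM.
rewrite RintZ; last exact: integ_norm.
rewrite mulrC ler_pM2r// ler_norm//.
Qed.

End Density.

(** * Smooth approximants with zero end values and prescribed integral *)

Section SmoothDensity.
Context {R : realType}.
Local Notation mu := (@lebesgue_measure R).
Implicit Types (f g h u v c phi psi : R -> R) (a b x y L : R).

Lemma h1_C1 L phi psi : continuous psi ->
  (forall x, x \in `[0, L] -> is_derive x 1 phi (psi x)) -> h1 L phi psi.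
Proof.
move=> cpsi dphi; split; first exact: sqint_cont.
move=> x xL; move: (xL); rewrite in_itv/= => /andP[x0 xL'].
move: x0; rewrite le_eqVlt => /predU1P[<-|x0].
  by rewrite set_itv1 Rintegral_set1 addr0.
have d0x y : y \in `[0, x] -> is_derive y 1 phi (psi y).
  rewrite in_itv/= => /andP[y0 yx]; apply: dphi.
  by rewrite in_itv/= y0 (le_trans yx).
have c0x y : y \in `[0, x] -> {for y, continuous phi}.
  move=> /d0x dy; apply/differentiable_continuous/derivable1_diffP.
  exact: ex_derive.
have oc y : y \in `]0, x[ -> y \in `[0, x] by exact: subset_itv_oo_cc.
rewrite /Rintegral (@continuous_FTC2 _ psi phi)//.
- by rewrite -EFinB /=; ring.
- exact: continuous_subspaceT.
- split.
  + by move=> y /oc yx; have dy := d0x y yx; exact: ex_derive.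
  + apply: cvg_at_right_filter; apply: c0x; by rewrite in_itv/= lexx ltW.
  + apply: cvg_at_left_filter; apply: c0x; by rewrite in_itv/= lexx ltW.
- by move=> y /oc yx; have dy := d0x y yx; rewrite derive1E derive_val.
Qed.

Lemma dense_cutoff L c M d : continuous c -> (forall t, `|c t| <= M) -> 0 < d ->
  exists e k, [/\ 0 < e, continuous k, forall t, `|k t| <= M,
    forall t, t <= e \/ L - e <= t -> k t = 0 & sqdist L c k < d].
Proof.
move=> cc cM d0.
(* A trapezoid: for positive [n] it vanishes up to distance [1/n] from the endpoints, as well as
   outside the interval, and equals 1 from distance [2/n] on. *)
pose chi n t : R := Num.max 0 (Num.min 1 (n%:R * Num.min t (L - t) - 1)).
have chi01 n t : 0 <= chi n t <= 1.
  by rewrite /chi le_max lexx/= ge_max ler01/= ge_min lexx.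
have cchi n : continuous (chi n).
  have c1 : continuous (fun t : R => Num.min t (L - t)).
    apply: (@min_fun_continuous _ R _ id (fun t : R => L - t)); first by move=> x; exact: cvg_id.
    by move=> x; apply: cvgB; [exact: cvg_cst|exact: cvg_id].
  have c2 : continuous (fun t : R => n%:R * Num.min t (L - t) - 1).
    move=> x; apply: cvgB; last exact: cvg_cst.
    by apply: cvgM; [exact: cvg_cst|exact: c1].
  have ccst (k : R) : continuous (fun _ : R => k) by move=> x; exact: cvg_cst.
  exact: (max_fun_continuous (ccst 0) (min_fun_continuous (ccst 1) c2)).
have ck n : continuous (fun t => chi n t * c t).
  by move=> x; apply: cvgM; [exact: cchi|exact: cc].
have : (fun n => sqdist L c (fun t => chi n t * c t)) @ \oo --> (0 : R).
  apply: (Rint_dominated_cvg0 _ (sqint_cont 0 L cc).2).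
  - move=> n; have : sqint 0 L (fun t => c t - chi n t * c t).
      by apply: sqintB; exact: sqint_cont.
    by case=> + _; exact: measurable_funX.
  - move=> n x _; rewrite ger0_norm ?sqr_ge0//.
    have -> : c x - chi n x * c x = (1 - chi n x) * c x by ring.
    rewrite exprMn ler_piMl ?sqr_ge0//; have /andP[] := chi01 n x; nra.
  - move=> x; rewrite in_itv/= => /andP[x0 xL]; apply: cvg_near_cst; near=> n.
    suff -> : chi n x = 1 by rewrite mul1r subrr expr0n.
    have m0 : 0 < Num.min x (L - x) by rewrite lt_min x0 subr_gt0.
    rewrite /chi min_l ?max_r// lerBrDr -ler_pdivrMr//.
    by near: n; exact: nbhs_infty_ger.
move/cvgrPdist_lt => /(_ d d0)[N _ /(_ N.+1 (leqnSn N))]; rewrite sub0r normrN => h.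
exists (N.+1%:R^-1), (fun t => chi N.+1 t * c t); split => //.
- move=> t; rewrite normrM; have /andP[h0 h1] := chi01 N.+1 t.
  by rewrite ger0_norm// (le_trans _ (cM t))// ler_piMl.
- move=> t ht; suff -> : chi N.+1 t = 0 by rewrite mul0r.
  rewrite /chi max_l// ge_min; apply/orP; right; rewrite subr_le0.
  rewrite mulrC -ler_pdivlMr// div1r ge_min.
  by case: ht => ht; apply/orP; [left|right; rewrite lerBlDr addrC -lerBlDr].
- by rewrite (le_lt_trans _ h)// ler_norm.
Unshelve. all: by end_near. Qed.

(** The base point -1 lies strictly below the intervals [[0, L]] of interest, so the derivative is
    two-sided at 0 as well. *)
Lemma continuous_antiderivative c : continuous c ->
  exists C, forall x, -1 < x -> is_derive x 1 C (c x).
Proof.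
move=> cc; exists (fun x => \int[mu]_(t in `[-1, x]) c t) => x x1.
have [] := @continuous_FTC1_closed _ c (-1) x (x + 1) _ (integ_cont _ _ cc) x1 (cc x).
  by lra.
by move=> dC CE; apply: DeriveDef; [exact: dC|rewrite -derive1E; exact: CE].
Qed.

(** Steklov averages: [phi n x] is the mean of [c] over [[x, x + s n]], hence C^1, and equals a
    value of [c] in that interval by the mean value theorem. This one fact gives the bound, the
    pointwise convergence and the zero end values. *)
Lemma dense_Steklov L c M e d : 0 <= L -> continuous c -> (forall t, `|c t| <= M) ->
  0 < e -> (forall t, t <= e \/ L - e <= t -> c t = 0) -> 0 < d ->
  exists phi psi, [/\ continuous psi, h1 L phi psi, phi 0 = 0, phi L = 0 &
    sqdist L c phi < d].
Proof.
move=> L0 cc cM e0 ce d0.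
have [C dC] := continuous_antiderivative cc.
pose s n : R := n.+1%:R^-1.
have s0 n : 0 < s n by rewrite /s.
pose phi n x := n.+1%:R * (C (x + s n) - C x).
pose psi n x := n.+1%:R * (c (x + s n) - c x).
have dphi n x : x \in `[0, L] -> is_derive x 1 (phi n) (psi n x).
  rewrite in_itv/= => /andP[x0 _].
  have xs1 : -1 < x + s n by have := s0 n; lra.
  have d1 : is_derive x 1 (C \o (fun y => y + s n)) (c (x + s n)).
    have dd := dC (x + s n) xs1.
    have -> : c (x + s n) = c (x + s n) * 1 by rewrite mulr1.
    apply: (@is_derive1_comp _ C (fun y => y + s n) x _ 1 dd).
    exact: is_derive_shift.
  have d2 : is_derive x 1 C (c x) by apply: dC; lra.
  exact: (is_deriveZ n.+1%:R (is_deriveB d1 d2)).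
have cpsi n : continuous (psi n).
  move=> x; apply: cvgM; first exact: cvg_cst.
  apply: cvgB; last exact: cc.
  apply: (continuous_comp (f := fun y => y + s n) (g := c)); last exact: cc.
  by apply: cvgD; [exact: cvg_id|exact: cvg_cst].
have hphi n : h1 L (phi n) (psi n) by apply: h1_C1 => // x; exact: dphi.
have mvt n x : 0 <= x -> exists2 y, y \in `]x, x + s n[ & phi n x = c y.
  move=> x0; have xs : x < x + s n by rewrite ltrDl.
  have dCx y : y \in `[x, x + s n] -> is_derive y 1 C (c y).
    by rewrite in_itv/= => /andP[xy _]; apply: dC; rewrite (lt_le_trans _ xy)// (lt_le_trans _ x0).
  have cont : {within `[x, x + s n], continuous C}.
    apply: continuous_in_subspaceT => y; rewrite inE/= => /dCx dy.
    exact/differentiable_continuous/derivable1_diffP/ex_derive.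
  have [y yI CE] := MVT xs (fun y yI => dCx y (subset_itv_oo_cc yI)) cont.
  by exists y => //; rewrite /phi CE addrC addKr mulrC -mulrA mulVf ?mulr1.
have : (fun n => sqdist L c (phi n)) @ \oo --> (0 : R).
  apply: (Rint_dominated_cvg0 _ (integ_cst _ _ ((2 * M) ^+ 2))).
  - move=> n; have : sqint 0 L (fun t => c t - phi n t).
      by apply: sqintB; [exact: sqint_cont|exact: h1_sqint (hphi n)].
    by case=> + _; exact: measurable_funX.
  - move=> n x; rewrite in_itv/= => /andP[x0 _].
    have M0 : 0 <= M by rewrite (le_trans _ (cM 0)).
    rewrite normrX lerXn2r ?nnegrE//; first by lra.
    have [y _ ->] := mvt n x x0.
    by rewrite (le_trans (ler_normB _ _))//; have := cM x; have := cM y; lra.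
  - move=> x; rewrite in_itv/= => /andP[/ltW x0 _].
    rewrite [X in _ --> X](_ : 0 = 0 ^+ 2); last by rewrite expr0n.
    apply: (cvg_comp _ (fun y => y ^+ 2)); last exact: exprn_continuous.
    apply/cvgrPdist_lt => r r0.
    have /cvgrPdist_lt /(_ r r0) [z /= z0 zP] := cc x.
    near=> n; rewrite sub0r normrN; have [y] := mvt n x x0.
    rewrite in_itv/= => /andP[xy yx] ->; apply: zP => /=.
    have : s n < z by near: n; exact: (near_infty_natSinv_lt (PosNum z0)).
    by rewrite ler0_norm ?subr_le0 ?ltW//; lra.
move/cvgrPdist_lt => /(_ d d0)[N _ NP].
(* With [s n < e], the average at 0 only sees points where [c] vanishes. *)
have [n [Nn ne]] : exists n, (N <= n)%N /\ s n < e.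
  have [N' _ N'P] := near_infty_natSinv_lt (PosNum e0).
  by exists (maxn N N'); split; [exact: leq_maxl|exact: (N'P _ (leq_maxr _ _))].
exists (phi n), (psi n); split => //.
- by have [y] := mvt n 0 (lexx 0); rewrite in_itv/= add0r => /andP[y0 ye] ->; apply: ce; left; lra.
- by have [y] := mvt n L L0; rewrite in_itv/= => /andP[y0 ye] ->; apply: ce; right; lra.
- by have := NP n Nn; rewrite /= sub0r normrN => h; rewrite (le_lt_trans _ h)// ler_norm.
Unshelve. all: by end_near. Qed.

Lemma h1_affine L a b : h1 L (fun x => a + b * x) (fun=> b).
Proof.
split; first exact: sqint_cst.
by move=> x; rewrite in_itv/= => /andP[x0 _]; rewrite Rint_cst//; ring.
Qed.

(** Equal integrals make the antiderivative of [phi] reach the same value at [L] as that of [g]. The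
    approximant from the previous steps is corrected by a multiple of a fixed bump vanishing at both
    ends. *)
Lemma dense_mean L g d : 0 < L -> sqint 0 L g -> 0 < d ->
  exists phi psi, [/\ continuous psi, h1 L phi psi, phi 0 = 0 /\ phi L = 0,
    \int[mu]_(t in `[0, L]) phi t = \int[mu]_(t in `[0, L]) g t &
    sqdist L g phi < d].
Proof.
move=> L0 gi d0.
(* The parabola [x (L - x)], written as a product of two affine functions so that [h1M] supplies its
   derivative. Its integral is positive because it is at least [(L / 3) ^+ 2] on the middle
   third. *)
pose b x := (0 + 1 * x) * (L + (- 1) * x).
pose b' x : R := (0 + 1 * x) * (- 1) + (L + (- 1) * x) * 1.
have hb : h1 L b b' by apply: (h1M (ltW L0) (h1_affine L 0 1) (h1_affine L L (-1))).
have bi : sqint 0 L b by exact: h1_sqint (ltW L0) hb.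
pose B := \int[mu]_(t in `[0, L]) b t.
have B0 : 0 < B.
  have b0 x : x \in `[0, L] -> 0 <= b x.
    by rewrite in_itv/= /b => /andP[x0 xL]; apply: mulr_ge0; lra.
  have L3 : 0 < L / 3 by lra.
  have s := @Rint_subitv_le _ 0 (L / 3) (2 * (L / 3)) L b (sqint_integ bi) _ _ _ b0.
  apply: (@lt_le_trans _ _ ((L / 3) ^+ 2 * (2 * (L / 3) - L / 3))).
    by apply: mulr_gt0; [exact: exprn_gt0|lra].
  apply: (le_trans _ (s _ _ _)); [|lra|lra|lra].
  rewrite -Rint_cst; last by lra.
  apply: le_Rint; [exact: integ_cst|by apply: integ_sub (sqint_integ bi) _ _; lra|].
  by move=> x; rewrite in_itv/= /b => /andP[x0 xL]; nra.
pose J := \int[mu]_(t in `[0, L]) (b t ^+ 2).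
have J0 : 0 <= J by apply: Rint_ge0 => x _; exact: sqr_ge0.
(* The loss caused by the correction: 2 from the triangle inequality, and twice [r ^+ 2 * J], where
   Cauchy-Schwarz bounds [r ^+ 2] by [L / B ^+ 2] times the squared distance. *)
pose K := 2 + 2 * (L * J / B ^+ 2).
have K0 : 0 < K.
  have : 0 <= L * J / B ^+ 2 by apply: divr_ge0; [apply: mulr_ge0; lra|exact: sqr_ge0].
  by rewrite /K; lra.
(* Four approximations, each passing through two triangle inequalities with factor 2, add up to
   [16 * d1]. *)
pose d1 := d / (K * 16).
have d10 : 0 < d1 by apply: divr_gt0 => //; lra.
have [M M0 sM] := dense_bounded gi d10.
set f1 := (fun t => clamp M (g t)) in sM.
have [c [cc cM sc]] := dense_continuous (ltW L0) (clamp_meas M0 gi.1) M0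
   (fun x => clamp_le (g x) M0) d10.
have [e [k [e0 ck kM ke sk]]] := dense_cutoff L cc cM d10.
have [phi [psi [cpsi hphi p0 pL sp]]] := dense_Steklov (ltW L0) ck kM e0 ke d10.
have phii := h1_sqint (ltW L0) hphi.
have f1i : sqint 0 L f1.
  apply: (sqint_bounded (k := 1) (clamp_meas M0 gi.1) (sqint_cst _ _ M)) => x _.
  by rewrite mul1r (ger0_norm M0); exact: clamp_le.
have ci := sqint_cont 0 L cc; have ki := sqint_cont 0 L ck.
have sgp : sqdist L g phi < 16 * d1.
  have t1 := sqdist_triangle gi f1i ci.
  have t2 := sqdist_triangle ci ki phii.
  have t3 := sqdist_triangle gi ci phii.
  have sc' : sqdist L f1 c < d1 := sc.
  have sM' : sqdist L g f1 < d1 := sM.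
  lra.
pose r := (\int[mu]_(t in `[0, L]) g t - \int[mu]_(t in `[0, L]) phi t) / B.
exists (fun t => phi t + r * b t), (fun t => psi t + r * b' t); split.
- move=> x; apply: cvgD; first exact: cpsi.
  apply: cvgM; first exact: cvg_cst.
  apply: cvgD; apply: cvgM; try exact: cvg_cst.
    by apply: cvgD; [exact: cvg_cst|apply: cvgM; [exact: cvg_cst|exact: cvg_id]].
  by apply: cvgD; [exact: cvg_cst|apply: cvgM; [exact: cvg_cst|exact: cvg_id]].
- by apply: h1D => //; exact: h1Z.
- by rewrite p0 pL /b; split; ring.
- rewrite RintD; [|exact: sqint_integ|exact/integZ/sqint_integ].
  rewrite RintZ -/B; last exact: sqint_integ.
  by rewrite /r divfK ?gt_eqF//; ring.
have r2 : r ^+ 2 * J <= (L * J / B ^+ 2) * sqdist L g phi.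
  have := Cauchy_Schwarz_mean (ltW L0) (sqintB gi phii); rewrite subr0 -/(sqdist L g phi).
  rewrite RintB; [|exact: sqint_integ|exact: sqint_integ] => cs.
  rewrite /r expr_div_n.
  have -> : L * J / B ^+ 2 * sqdist L g phi = (L * sqdist L g phi) / B ^+ 2 * J by ring.
  by apply: ler_wpM2r => //; apply: ler_wpM2r => //; rewrite invr_ge0 sqr_ge0.
have rbi : sqint 0 L (fun t => phi t + r * b t) by apply: sqintD => //; exact: sqintZ.
have t := sqdist_triangle gi phii rbi.
have sJ : sqdist L phi (fun t => phi t + r * b t) = r ^+ 2 * J.
  rewrite /sqdist /J -RintZ; last by case: bi.
  by apply: eq_Rint => x _; ring.
rewrite sJ in t; apply: (le_lt_trans t).
apply: (@le_lt_trans _ _ (K * sqdist L g phi)); first by rewrite /K; lra.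
have -> : d = K * (16 * d1) by rewrite /d1; field; rewrite gt_eqF.
by rewrite ltr_pM2l.
Qed.

End SmoothDensity.

(** * Approximation on one edge *)

Section EdgeApproximation.
Context {R : realType}.
Local Notation mu := (@lebesgue_measure R).
Implicit Types (f g h p q u v phi psi : R -> R) (a b x y L : R).

(** The difference [g - h], extended by 0, has zero integral over every [[-1, y]]; Lebesgue
    differentiation then makes it vanish almost everywhere on [[0, L]]. *)
Lemma h1_derivative_unique L u g h : h1 L u g -> h1 L u h ->
  {ae mu, forall x, x \in `[0, L] -> g x = h x}.
Proof.
move=> [gi uE] [hi uE'].
pose d x := g x - h x; pose D := d \_ `[0, L].
have di : integ 0 L d by apply: integB; exact: sqint_integ.
have Dy y : mu.-integrable [set` Interval (BLeft (-1)) (BRight y)] (EFin \o D).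
  rewrite /D -restrict_EFin; apply: (integrableS measurableT) => //.
  exact: ((integrable_mkcond (mu := mu) (EFin \o d) (measurable_itv `[0, L])).1 di).
have D0 y : \int[mu]_(t in [set` Interval (BLeft (-1)) (BRight y)]) D t = 0.
  rewrite /D -Rintegral_mkcondr.
  have [y0|y0] := ltP y 0.
    have -> : [set` Interval (BLeft (-1)) (BRight y)] `&` `[0, L]%classic = set0.
      apply/seteqP; split => x //=; rewrite !in_itv/= => -[/andP[_ xy] /andP[x0 _]].
      by have := lt_le_trans y0 (le_trans x0 xy); rewrite ltxx.
    by rewrite Rintegral_set0.
  have [L0|L0] := ltP L 0.
    by rewrite (@set_itv_ge _ _ (BLeft 0) (BRight L)) ?bnd_simp -?ltNge// setI0 Rintegral_set0.
  have zI : Num.min y L \in `[0, L] by rewrite in_itv/= le_min y0 L0 ge_min lexx orbT.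
  have -> : [set` Interval (BLeft (-1)) (BRight y)] `&` `[0, L]%classic = `[0, Num.min y L]%classic.
    apply/seteqP; split => x /=; rewrite !in_itv/= le_min.
      by move=> [/andP[_ ->] /andP[-> ->]].
    by move=> /and3P[x0 -> ->]; rewrite x0 (le_trans _ x0).
  have := uE' _ zI; rewrite (uE _ zI) => /addrI e.
  move: zI; rewrite in_itv/= => /andP[z0 zL].
  rewrite RintB ?e ?subrr//; [exact: integ_sub (sqint_integ gi) _ _|].
  exact: integ_sub (sqint_integ hi) _ _.
have := FTC1 Dy (integrable_locally (measurable_itv _) di).
have -> : (fun x : R => \int[mu]_(t in [set` Interval (BLeft (-1)) (BRight x)]) D t) = cst 0.
  by apply/funext => y; rewrite D0.
apply: filterS; first exact: (ae_filter_ringOfSetsType mu).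
move=> x /= xP xL; move: (xL); rewrite in_itv/= => /andP[x0 _].
have [|_] := xP; first by rewrite lte_fin; lra.
rewrite derive1_cst /D patchE mem_set// /d => /esym/eqP.
by rewrite subr_eq0 => /eqP.
Qed.

Definition h1dist L u g v h := sqdist L u v + sqdist L g h.

Lemma h1dist_triangle L u g v h w k : 0 <= L -> h1 L u g -> h1 L v h -> h1 L w k ->
  h1dist L u g w k <= 2 * h1dist L u g v h + 2 * h1dist L v h w k.
Proof.
move=> L0 ug vh wk; have t1 := sqdist_triangle (h1_sqint L0 ug) (h1_sqint L0 vh) (h1_sqint L0 wk).
by have t2 := sqdist_triangle ug.1 vh.1 wk.1; rewrite /h1dist; lra.
Qed.

Lemma h1dist0 L u g : h1dist L u g (fun=> 0) (fun=> 0) = energy L u g.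
Proof.
by rewrite /h1dist /sqdist /energy; congr (_ + _); apply: eq_Rint => x _; rewrite subr0.
Qed.

Lemma h1dist_energy L u g v h :
  h1dist L u g v h = energy L (fun x => u x - v x) (fun x => g x - h x).
Proof. by []. Qed.

Lemma energy_le L u g c : 0 <= L -> h1 L u g -> 
  (forall x, x \in `[0, L] -> u x ^+ 2 + g x ^+ 2 <= c) -> energy L u g <= c * L.
Proof.
move=> L0 ug uc; have [_ ui] := h1_sqint L0 ug; have [[_ gi] _] := ug.
rewrite /energy -RintD// -[X in _ <= _ * X]subr0 -Rint_cst//.
apply: le_Rint => //; [exact: integD|exact: integ_cst].
Qed.

(** On [[0, L]] this is a C^2 function [p] with derivatives [phi] and [psi] and zero slope at both
    ends. Continuity of [psi] is what later turns the zero slopes into limits of difference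
    quotients. *)
Definition flat L p phi psi :=
  [/\ continuous psi, h1 L phi psi, h1 L p phi, phi 0 = 0 & phi L = 0].

(** Integrate from [u 0] an approximant of [g] with the same integral as [g]. By Cauchy-Schwarz
    [(u x - p x) ^+ 2] is at most [L] times the squared distance of the derivatives, whence the
    factor [1 + L * L]. *)
Lemma flat_dense L u g d : 0 < L -> h1 L u g -> 0 < d ->
  exists p phi psi, [/\ flat L p phi psi, p 0 = u 0, p L = u L &
    h1dist L u g p phi < d].
Proof.
move=> L0 ug d0; have [gi uE] := ug.
have c0 : 0 < 1 + L * L by have := mulr_gt0 L0 L0; lra.
have [phi [psi [cpsi hphi [p0 pL] me sg]]] := dense_mean L0 gi (divr_gt0 d0 c0).
have phii := h1_sqint (ltW L0) hphi.
pose p x := u 0 + \int[mu]_(t in `[0, x]) phi t.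
have pE0 : p 0 = u 0 by rewrite /p set_itv1 Rintegral_set1 addr0.
have hp : h1 L p phi by split => // x _; rewrite pE0.
have LI : L \in `[0, L] by rewrite in_itv/= lexx ltW.
exists p, phi, psi; split => //.
  by rewrite /p me -uE.
have dd := h1B ug hp.
have di : sqint 0 L (fun x => g x - phi x) by exact: sqintB.
have pt x : x \in `[0, L] -> (u x - p x) ^+ 2 <= L * sqdist L g phi.
  move=> xI; have := dd.2 x xI; rewrite pE0 subrr add0r => ->.
  move: xI; rewrite in_itv/= => /andP[x0 xL].
  have di' := sqint_sub di (lexx 0) xL.
  rewrite (le_trans (Cauchy_Schwarz_mean x0 di'))// subr0.
  apply: ler_pM => //; first by apply: Rint_ge0 => t _; exact: sqr_ge0.
  by apply: (Rint_subitv_le di.2) => // t _; exact: sqr_ge0.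
have : sqdist L u p <= (L * sqdist L g phi) * L.
  rewrite -[X in _ <= _ * X]subr0 -Rint_cst; last exact: ltW.
  apply: le_Rint => //; last exact: integ_cst.
  by case: (h1_sqint (ltW L0) dd).
rewrite ltr_pdivlMr// in sg; rewrite /h1dist; lra.
Qed.

Lemma flat0 L : flat L (fun=> 0) (fun=> 0) (fun=> 0).
Proof.
have h0 : h1 L (fun=> 0 : R) (fun=> 0).
  by have := h1_affine L 0 0; under eq_fun do rewrite mul0r addr0.
by split => // x; exact: cvg_cst.
Qed.

Lemma flat_perturb L u g d : 0 < L -> h1 L u g -> 0 < d ->
  exists2 e, 0 < e & forall a b, `|u 0 - a| <= e -> `|u L - b| <= e ->
  exists p phi psi, [/\ flat L p phi psi, p 0 = a, p L = b & h1dist L u g p phi < d].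
Proof.
move=> L0 ug d0.
(* An affine function with end values at most [e] in absolute value is bounded by [3 * e] and has
   slope at most [2 * e / L]; the sum of the two squares is [e ^+ 2 * k]. *)
pose k := 9 + 4 / L ^+ 2.
have k0 : 0 < k.
  have : 0 < 4 / L ^+ 2 by apply: divr_gt0 => //; exact: exprn_gt0.
  by rewrite /k; lra.
pose m := 4 * (k * L) / d.
have m0 : 0 < m by apply: divr_gt0 => //; rewrite !mulr_gt0.
(* Being at most 1 and less than [1 / m], this radius has its square below [1 / m] too, which is the
   bound required. *)
exists (1 / (1 + m)); first by apply: divr_gt0; lra.
set e := _ / _ => a b ea eb.
have e0 : 0 < e by apply: divr_gt0; lra.
have e2 : 4 * (e ^+ 2 * k * L) < d.
  have : e ^+ 2 < d / (4 * (k * L)).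
    have -> : d / (4 * (k * L)) = m^-1 by rewrite /m invf_div.
    have e1 : e <= 1 by rewrite /e ler_pdivrMr; lra.
    apply: (@le_lt_trans _ _ e); first by rewrite expr2 ler_piMr// ltW.
    by rewrite /e div1r ltf_pV2 ?posrE//; lra.
  rewrite ltr_pdivlMr; last by rewrite !mulr_gt0.
  lra.
pose al := a - u 0; pose be := (b - u L - al) / L.
have qh := h1_affine L al be.
pose q x := u x + (al + be * x).
have hq : h1 L q (fun x => g x + be) by exact: h1D.
have d4 : 0 < d / 4 by lra.
have [p [phi [psi [fl p0 pL pd]]]] := flat_dense L0 hq d4.
exists p, phi, psi; split => //.
- by rewrite p0 /q /al; ring.
- by rewrite pL /q /be /al; field; rewrite gt_eqF.
have hp : h1 L p phi by case: fl.
apply: (le_lt_trans (h1dist_triangle (ltW L0) ug hq hp)).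
suff : h1dist L u g q (fun x => g x + be) <= e ^+ 2 * k * L by lra.
have -> : h1dist L u g q (fun x => g x + be) = energy L (fun x => al + be * x) (fun=> be).
  rewrite /h1dist /sqdist /energy; congr (_ + _); apply: eq_Rint => x _; rewrite /q; ring.
apply: energy_le => //; first exact: ltW.
have ala : `|al| <= e by rewrite /al distrC.
have bea : `|be * L| <= 2 * e.
  rewrite /be divfK ?gt_eqF// (le_trans (ler_normB _ _))// distrC; lra.
have be2 : be ^+ 2 <= e ^+ 2 * (4 / L ^+ 2).
  have -> : be ^+ 2 = (`|be * L| ^+ 2) / L ^+ 2.
    by rewrite real_normK ?num_real// [in RHS]exprMn [RHS]mulfK// gt_eqF// exprn_gt0.
  rewrite mulrA ler_pM2r ?invr_gt0 ?exprn_gt0//.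
  have -> : e ^+ 2 * 4 = (2 * e) ^+ 2 by ring.
  by rewrite lerXn2r ?nnegrE//; lra.
move=> x; rewrite in_itv/= => /andP[x0 xL].
have bex : `|al + be * x| <= 3 * e.
  rewrite (le_trans (ler_normD _ _))//.
  suff : `|be * x| <= `|be * L| by lra.
  by rewrite !normrM ler_wpM2l// !ger0_norm// ltW.
have : (al + be * x) ^+ 2 <= (3 * e) ^+ 2.
  rewrite -(real_normK (num_real (_ + _))) lerXn2r ?nnegrE//; lra.
rewrite /k; lra.
Qed.

(* For short edges the affine interpolant does not increase the Dirichlet
   energy; for long edges multiplying by an affine weight costs a bounded
   factor. *)
Lemma h1_interpolation L u g a b : 0 < L -> h1 L u g ->
  `|a| <= `|u 0| -> `|b| <= `|u L| -> `|a - b| <= `|u 0 - u L| ->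
  exists q k, [/\ h1 L q k, q 0 = a, q L = b & energy L q k <= 10 * energy L u g].
Proof.
move=> L0 ug ua ub uab; have [gi uE] := ug; have ui := h1_sqint (ltW L0) ug.
have I0 : 0 \in `[0, L] by rewrite in_itv/= lexx ltW.
have IL : L \in `[0, L] by rewrite in_itv/= lexx ltW.
pose U := \int[mu]_(t in `[0, L]) (u t ^+ 2).
pose V := \int[mu]_(t in `[0, L]) (g t ^+ 2).
have U0 : 0 <= U by apply: Rint_ge0 => t _; exact: sqr_ge0.
have V0 : 0 <= V by apply: Rint_ge0 => t _; exact: sqr_ge0.
have EE : energy L u g = U + V by [].
(* For [L <= 1], [h1_end] bounds [L * u x ^+ 2] by twice the energy at either end, and
   Cauchy-Schwarz bounds the Dirichlet energy of the affine interpolant by that of [u]. *)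
have [L1|L1] := leP L 1.
  exists (fun x => a + (b - a) / L * x), (fun=> (b - a) / L); split.
  - exact: h1_affine.
  - by ring.
  - by field; rewrite gt_eqF.
  have sq x y : `|x| <= `|y| -> x ^+ 2 <= y ^+ 2.
    by move=> xy; rewrite -(real_normK (num_real x)) -(real_normK (num_real y)) lerXn2r ?nnegrE.
  have e1 := h1_end ug I0; have e2 := h1_end ug IL.
  have s1 := sq _ _ ua; have s2 := sq _ _ ub; have s3 := sq _ _ uab.
  rewrite /energy Rint_cst ?subr0; last exact: ltW.
  have : \int[mu]_(t in `[0, L]) (a + (b - a) / L * t) ^+ 2 <= (u 0 ^+ 2 + u L ^+ 2) * (L - 0).
    rewrite -Rint_cst; last exact: ltW.
    have hi := h1_sqint (ltW L0) (h1_affine L a ((b - a) / L)).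
    apply: le_Rint; [by case: hi|exact: integ_cst|].
    move=> x; rewrite in_itv/= => /andP[x0 xL].
    have -> : a + (b - a) / L * x = a + (b - a) * (x / L) by ring.
    have t0 : 0 <= x / L by apply: divr_ge0 => //; exact: ltW.
    have t1 : x / L <= 1 by rewrite ler_pdivrMr// mul1r.
    set t := x / L in t0 t1 *.
    have : (a + (b - a) * t) ^+ 2 <= (1 - t) * a ^+ 2 + t * b ^+ 2.
      rewrite -subr_ge0.
      have -> : (1 - t) * a ^+ 2 + t * b ^+ 2 - (a + (b - a) * t) ^+ 2 =
        t * (1 - t) * (a - b) ^+ 2 by ring.
      by apply: mulr_ge0; [apply: mulr_ge0 => //; lra|exact: sqr_ge0].
    have : (1 - t) * a ^+ 2 <= a ^+ 2 by rewrite ler_piMl ?sqr_ge0//; lra.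
    have : t * b ^+ 2 <= b ^+ 2 by rewrite ler_piMl ?sqr_ge0.
    lra.
  have : ((b - a) / L) ^+ 2 * L <= V.
    have -> : ((b - a) / L) ^+ 2 * L = (a - b) ^+ 2 / L by field; rewrite gt_eqF.
    rewrite ler_pdivrMr// (le_trans s3)// mulrC.
    have -> : (u 0 - u L) ^+ 2 = (\int[mu]_(t in `[0, L]) g t) ^+ 2.
      by rewrite (uE L IL); ring.
    by have := Cauchy_Schwarz_mean (ltW L0) gi; rewrite subr0.
  move: e1 e2; rewrite EE -/U -/V; nra.
(* For long edges write [a = l * u 0] and [b = m * u L] with factors in [[-1, 1]]; the affine weight
   from [l] to [m] has slope at most [2 / L], hence at most 2. The integrand is then at most
   [9 * u ^+ 2 + 2 * g ^+ 2]. *)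
have un0 (c v : R) : `|c| <= `|v| -> exists2 w, `|w| <= 1 & c = w * v.
  move=> cv; have [v0|v0] := eqVneq v 0.
    exists 0; first by rewrite normr0.
    by move: cv; rewrite v0 normr0 normr_le0 mulr0 => /eqP.
  by exists (c / v); [rewrite normf_div ler_pdivrMr ?normr_gt0// mul1r|rewrite divfK].
have [l l1 al] := un0 _ _ ua; have [m m1 bm] := un0 _ _ ub.
pose w x := l + (m - l) / L * x.
have hw : h1 L w (fun=> (m - l) / L) by exact: h1_affine.
exists (fun x => w x * u x), (fun x => w x * g x + u x * ((m - l) / L)); split.
- exact: h1M (ltW L0) hw ug.
- by rewrite /w al; ring.
- by rewrite /w bm; field; rewrite gt_eqF.
have hq := h1M (ltW L0) hw ug.
have [_ qi] := h1_sqint (ltW L0) hq; have [[_ ki] _] := hq.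
rewrite EE /energy -RintD//.
have i1 : integ 0 L (fun t => 9 * u t ^+ 2 + 2 * g t ^+ 2).
  by apply: integD; apply: integZ; [case: ui|case: gi].
apply: (@le_trans _ _ (\int[mu]_(t in `[0, L]) (9 * u t ^+ 2 + 2 * g t ^+ 2))).
  apply: le_Rint => //; first exact: integD.
  move=> x; rewrite in_itv/= => /andP[x0 xL].
  have t0 : 0 <= x / L by apply: divr_ge0 => //; exact: ltW.
  have t1 : x / L <= 1 by rewrite ler_pdivrMr// mul1r.
  have w1 : `|w x| <= 1.
    have -> : w x = (1 - x / L) * l + x / L * m by rewrite /w; ring.
    move: (x / L) t0 t1 => t t0 t1.
    rewrite (le_trans (ler_normD _ _))// !normrM (ger0_norm t0) ger0_norm; last by lra.
    by nra.
  have w2 : w x ^+ 2 <= 1.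
    by rewrite -(real_normK (num_real (w x))) expr_le1.
  have z1 : `|(m - l) / L| <= 2.
    rewrite normf_div (gtr0_norm L0) ler_pdivrMr// (le_trans (ler_normB _ _))//.
    lra.
  have z2 : ((m - l) / L) ^+ 2 <= 4.
    have -> : (4 : R) = 2 ^+ 2 by ring.
    by rewrite -(real_normK (num_real (_ / _))) lerXn2r ?nnegrE.
  set z := _ / L in z1 z2 *.
  have : (w x * g x + u x * z) ^+ 2 <= 2 * (w x ^+ 2 * g x ^+ 2) + 2 * (z ^+ 2 * u x ^+ 2).
    by have := sqr_ge0 (w x * g x - u x * z); nra.
  have := ler_wpM2r (sqr_ge0 (u x)) w2; have := ler_wpM2r (sqr_ge0 (g x)) w2.
  have := ler_wpM2r (sqr_ge0 (u x)) z2.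
  by rewrite [(w x * u x) ^+ 2]exprMn; lra.
rewrite RintD; [|by apply: integZ; case: ui|by apply: integZ; case: gi].
rewrite !RintZ; [|by case: gi|by case: ui].
rewrite -/U -/V; lra.
Qed.

(** The last clause keeps the glued function supported on finitely many edges. The constant is
    [2 * (2 + 2 * 10) + 2]: an interpolant of energy at most 10 times that of [u], two triangle
    inequalities, and a flat approximant within one further energy. *)
Lemma flat_interpolation L u g a b : 0 < L -> h1 L u g ->
  `|a| <= `|u 0| -> `|b| <= `|u L| -> `|a - b| <= `|u 0 - u L| ->
  exists p phi psi, [/\ flat L p phi psi, p 0 = a, p L = b,
    h1dist L u g p phi <= 46 * energy L u g & (a = 0 -> b = 0 -> p = (fun=> 0))].
Proof.
move=> L0 ug ua ub uab.
have E0 := energy_ge0 L u g.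
have [[a0 b0]|nz] := pselect (a = 0 /\ b = 0).
  exists (fun=> 0), (fun=> 0), (fun=> 0); split => //; first exact: flat0.
  by rewrite h1dist0; lra.
(* The energy itself serves as the approximation tolerance, so it must be positive: were it 0, [u]
   would vanish and force [a = b = 0]. *)
have E1 : 0 < energy L u g.
  rewrite lt_neqAle E0 andbT eq_sym; apply/negP => /eqP EE; apply: nz.
  have e x : x \in `[0, L] -> u x = 0.
    move=> xI; have := h1_end ug xI; rewrite EE mulr0 pmulr_rle0// => h.
    by apply/eqP; rewrite -sqrf_eq0 eq_le h sqr_ge0.
  have u0 : u 0 = 0 by apply: e; rewrite in_itv/= lexx ltW.
  have uL : u L = 0 by apply: e; rewrite in_itv/= lexx ltW.
  move: ua ub; rewrite u0 uL !normr0 !normr_le0.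
  by move=> /eqP -> /eqP ->.
have [q [k [hq q0 qL qE]]] := h1_interpolation L0 ug ua ub uab.
have [p [phi [psi [fl p0 pL pd]]]] := flat_dense L0 hq E1.
exists p, phi, psi; split => //; rewrite ?p0 ?pL//; last by move=> a0 b0; case: nz.
have hp : h1 L p phi by case: fl.
have h0 : h1 L (fun=> 0 : R) (fun=> 0) by case: (flat0 L).
have t1 := h1dist_triangle (ltW L0) ug hq hp.
have t2 := h1dist_triangle (ltW L0) ug h0 hq.
have : h1dist L (fun=> 0) (fun=> 0) q k = energy L q k.
  rewrite -h1dist0 /h1dist /sqdist.
  by congr (_ + _); apply: eq_Rint => x _; rewrite sub0r subr0 sqrrN.
move: t2; rewrite h1dist0; lra.
Qed.

End EdgeApproximation.

(** * Paths and components *)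

Section GraphTopology.
Context {R : realType} {G : metric_graph R}.
Implicit Types (e : edge G) (u v w x : vert G) (P : set (edge G)) (t : R).

Lemma edge_map_ind e t (Q : mg_point G -> Prop) : 
    (forall h : 0 < t < len e, Q (Inner e h)) ->
  (~ (0 < t < len e) -> Q (Vertex (if t <= 0 then src e else tgt e))) ->
  Q (edge_map e t).
Proof.
by move=> QI QV; rewrite /edge_map; destruct idP as [h|h]; [exact: QI|exact: QV].
Qed.

Lemma edge_map_inner e t (te : 0 < t < len e) : edge_map e t = Inner e te.
Proof.
apply: (@edge_map_ind e t (eq^~ (Inner e te))) => [h|/(_ te)//].
by congr Inner; exact: bool_irrelevance.
Qed.

Lemma edge_map_src e t : t <= 0 -> edge_map e t = Vertex (src e).
Proof.
move=> t0; apply: (@edge_map_ind e t (eq^~ _)) => [h|_]; last by rewrite t0.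
by have /andP[] := h; rewrite ltNge t0.
Qed.

Lemma edge_map_tgt e t : len e <= t -> edge_map e t = Vertex (tgt e).
Proof.
move=> te; apply: (@edge_map_ind e t (eq^~ _)) => [h|_].
  by have /andP[_] := h; rewrite ltNge te.
by rewrite leNgt (lt_le_trans (len_gt0 e) te).
Qed.

Lemma mg_openE (U : set (mg_point G)) : open U = mg_open U.
Proof. by []. Qed.

Lemma edge_map_continuous e : continuous (edge_map e).
Proof. by apply/continuousP => U; rewrite mg_openE; apply. Qed.

Lemma mg_continuous (T : topologicalType) (f : mg_point G -> T) :
  (forall e, continuous (f \o edge_map e)) -> continuous f.
Proof.
move=> fc; apply/continuousP => U oU; rewrite mg_openE => e.
by move/continuousP : (fc e) => /(_ U oU).
Qed.

Definition adj_in P u v : bool := `[< exists2 e, P e &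
  (src e = u /\ tgt e = v) \/ (src e = v /\ tgt e = u) >].

Definition conn P u v := exists p, path (adj_in P) u p /\ last u p = v.

Lemma adj_inC P u v : adj_in P u v = adj_in P v u.
Proof. by apply/asboolP/asboolP => -[e Pe [|]]; exists e => //; [right|left|right|left]. Qed.

Lemma adj_in_edge P e : P e -> adj_in P (src e) (tgt e).
Proof. by move=> Pe; apply/asboolP; exists e => //; left. Qed.

Lemma adj_inS P Q u v : P `<=` Q -> adj_in P u v -> adj_in Q u v.
Proof. by move=> PQ /asboolP[e Pe h]; apply/asboolP; exists e => //; exact: PQ. Qed.

Lemma adj_in_mg P u v : adj_in P u v -> mg_adj u v.
Proof. by move=> /asboolP[e _ h]; apply/asboolP; exists e. Qed.

Lemma conn_refl P u : conn P u u.
Proof. by exists [::]. Qed.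

Lemma conn_trans P v u w : conn P u v -> conn P v w -> conn P u w.
Proof.
by move=> [p [pp <-]] [q [qq <-]]; exists (p ++ q); rewrite cat_path last_cat pp.
Qed.

Lemma conn_step P u v : adj_in P u v -> conn P u v.
Proof. by move=> uv; exists [:: v]; rewrite /= uv. Qed.

Lemma conn_sym P u v : conn P u v -> conn P v u.
Proof.
move=> [p]; elim: p u => [u [_ <-]|w p ih u /= [/andP[uw wp] lp]]; first exact: conn_refl.
apply: conn_trans (ih w (conj wp lp)) _; apply: conn_step; by rewrite adj_inC.
Qed.

Lemma connS P Q u v : P `<=` Q -> conn P u v -> conn Q u v.
Proof.
by move=> PQ [p [pp lp]]; exists p; split => //; apply: sub_path pp => x y; exact: adj_inS.
Qed.

Lemma conn_edge P e : P e -> conn P (src e) (tgt e).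
Proof. by move=> Pe; exact/conn_step/adj_in_edge. Qed.

Lemma connT u v : conn setT u v.
Proof.
have [p [pp lp]] := graph_connected u v; exists p; split => //.
by apply: sub_path pp => x y /asboolP[e h]; apply/asboolP; exists e.
Qed.

(** Shortening the path to a simple one makes its edges distinct, so their total is part of the sum
    over [P]. *)
Lemma conn_energy P (h : vert G -> R) (E : edge G -> \bar R) u v :
  (forall e, 0 <= E e)%E ->
  (forall e, P e -> (`|h (tgt e) - h (src e)|%:E <= E e)%E) ->
  conn P u v -> (`|h u - h v|%:E <= \esum_(e in P) E e)%E.
Proof.
move=> E0 hE [p [pp <-]]; case/shortenP : pp => q + + _.
suff H : path (adj_in P) u q -> uniq (u :: q) -> exists es : seq (edge G),
   [/\ uniq es, forall e, e \in es -> P e,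
    forall e, e \in es -> src e \in u :: q /\ tgt e \in u :: q &
    (`|h u - h (last u q)|%:E <= \sum_(e <- es) E e)%E].
  move=> /H{}H /H[es [ues esP _ hes]].
  rewrite (le_trans hes)// fsbig_seq//; apply: esum_ge; exists [set` es] => //.
  split; first exact: finite_seq.
  by move=> e /=; exact: esP.
elim: q u => [u _ _|w q ih u /= /andP[uw wq] /andP[uwq wuq]].
  by exists [::]; split => //=; rewrite subrr normr0 big_nil.
have [es [ues esP esin hes]] := ih w wq wuq.
move: (uw) => /asboolP[e Pe ew].
have ene : e \notin es.
  apply/negP => /esin[e1 e2]; case: ew => -[eu ev].
    by move: uwq; rewrite -eu e1.
  by move: uwq; rewrite -ev e2.
exists (e :: es); split.
- by rewrite /= ene.
- by move=> e'; rewrite inE => /predU1P[->|/esP].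
- move=> e'; rewrite inE => /predU1P[->|/esin[h1 h2]].
    by case: ew => -[-> ->]; rewrite !inE !eqxx ?orbT.
  by rewrite in_cons h1 orbT in_cons h2 orbT.
have he : (`|h u - h w|%:E <= E e)%E.
  by rewrite (le_trans _ (hE e Pe))// lee_fin; case: ew => -[-> ->] //; rewrite distrC.
rewrite big_cons /=; apply: le_trans (leeD he hes).
by rewrite -EFinD lee_fin -[h u - _](subrKA (h w)) ler_normD.
Qed.

Definition incident v : set (edge G) := [set e | src e = v \/ tgt e = v].

(** A fixed exhaustion of the edge set by finite sets, given by its enumeration. The components left
    after deleting [early n] play the role of complements of compact sets. *)
Definition early n : set (edge G) := [set e | (pickle e < n)%N].

Lemma early_finite n : finite_set (early n).
Proof.
apply: (@finite_preimage _ _ `I_n pickle); last exact: finite_II.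
by move=> e e' _ _; exact: (pcan_inj pickleK).
Qed.

Lemma earlyS n m : (n <= m)%N -> early n `<=` early m.
Proof. by move=> nm e /= en; exact: leq_trans nm. Qed.

Lemma finite_early (A : set (edge G)) : finite_set A -> exists n, A `<=` early n.
Proof.
move=> /finite_seqP[s ->]; exists (\max_(e <- s) (pickle e).+1)%N => e /= es.
by apply: (@leq_bigmax_seq _ s xpredT (fun e => (pickle e).+1)).
Qed.

(** Follow a path from [v] to [v0] until it is about to use an edge of [F]. Hence deleting finitely
    many edges leaves finitely many components, and the pigeonhole principle applies to them. *)
Lemma conn_finite_set (F : set (edge G)) v0 v : exists2 x,
  ([set v0] `|` src @` F `|` tgt @` F) x & conn (~` F) x v.
Proof.
have [p] := connT v v0; elim: p v => [v [_ /= ->]|w p ih v /= [/andP[vw wp] lp]].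
  by exists v0; [left; left|exact: conn_refl].
move: (vw) => /asboolP[e _ ev]; have [eF|eF] := pselect (F e).
  exists v; last exact: conn_refl.
  by case: ev => -[h1 h2]; [left; right; exists e|right; exists e].
have [x Xx xw] := ih w (conj wp lp); exists x => //; apply: conn_trans xw _.
by apply: conn_step; rewrite adj_inC; apply/asboolP; exists e.
Qed.

Lemma infinite_component (F : set (edge G)) (S : set (vert G)) :
  finite_set F -> infinite_set S -> exists x, infinite_set (S `&` conn (~` F) x).
Proof.
move=> finF infS; apply: contrapT => /forallNP nx; apply: infS.
have [v0] : [set: vert G] !=set0 by apply: infinite_setN0; exact: vert_infinite.
move=> _; set X := [set v0] `|` src @` F `|` tgt @` F.
apply: (@sub_finite_set _ _ (\bigcup_(x in X) (S `&` conn (~` F) x))).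
  by move=> s Ss; have [x Xx xs] := conn_finite_set F v0 s; exists x.
apply: bigcup_finite.
  rewrite !finite_setU; split; [split|]; try exact: finite_image.
  exact: finite_set1.
by move=> x _; exact: contrapT (nx x).
Qed.

(** The pigeonhole principle is applied to the part of [S] inside the current component, so the next
    component meets the current one and, avoiding more edges, lies within it. *)
Lemma nested_components (S : set (vert G)) : infinite_set S ->
  exists x : nat -> vert G,
    (forall n, infinite_set (S `&` conn (~` early n) (x n))) /\
    forall n, conn (~` early n.+1) (x n.+1) `<=` conn (~` early n) (x n).
Proof.
move=> infS.
have step n x : infinite_set (S `&` conn (~` early n) x) ->
    {y | infinite_set (S `&` conn (~` early n.+1) y) /\
         conn (~` early n.+1) y `<=` conn (~` early n) x}.
  move=> infx; apply: cid.
  have [y infy] := infinite_component (early_finite n.+1) infx.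
  exists y; split.
    by apply: sub_infinite_set infy => z [[Sz _] yz].
  have [z [[_ xz] yz]] := infinite_setN0 infy.
  have sub : ~` early n.+1 `<=` ~` early n by apply: subsetC; exact: earlyS.
  move=> w /(connS sub) yw; apply: conn_trans xz _.
  by apply: conn_trans yw; exact/conn_sym/(connS sub).
pose T n := {x | infinite_set (S `&` conn (~` early n) x)}.
have [x0 inf0] := cid (infinite_component (early_finite 0) infS).
(* The recursion carries the proof that the component is infinite, since [step] needs it as
   input. *)
pose X := nat_rect T (exist _ x0 inf0)
  (fun n (s : T n) => let y := step n _ (proj2_sig s) in
    exist _ (projT1 y) (projT2 y).1).
exists (fun n => proj1_sig (X n)); split; first by move=> n; exact: (proj2_sig (X n)).
by move=> n; exact: (projT2 (step n _ (proj2_sig (X n)))).2.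
Qed.

End GraphTopology.

(** * Open stars and the ends they represent *)

Section Stars.
Context {R : realType} {G : metric_graph R}.
Implicit Types (e : edge G) (u v w x : vert G) (P : set (edge G)) (t : R)
  (W : set (vert G)).

(** Incident open edges are taken whole, so the boundary of a star consists of vertices only. *)
Definition star W : set (mg_point G) := fun p =>
  match p with
  | Vertex w => W w
  | Inner e _ _ => W (src e) \/ W (tgt e)
  end.

Definition edge_interior e : set (mg_point G) := fun p =>
  match p with
  | Vertex _ => False
  | Inner e' _ _ => e' = e
  end.

Variant edge_map_spec e t : mg_point G -> Prop :=
| EdgeMapSrc of t <= 0 : edge_map_spec e t (Vertex (src e))
| EdgeMapTgt of len e <= t : edge_map_spec e t (Vertex (tgt e))
| EdgeMapInner (h : 0 < t < len e) : edge_map_spec e t (Inner e h).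

Lemma edge_mapP e t : edge_map_spec e t (edge_map e t).
Proof.
have [t0|t0] := leP t 0; first by rewrite edge_map_src//; constructor.
have [te|te] := leP (len e) t; first by rewrite edge_map_tgt//; constructor.
by have h : 0 < t < len e by [rewrite t0]; rewrite (edge_map_inner h); constructor.
Qed.

Lemma star_open W : open (star W).
Proof.
rewrite mg_openE => e.
have l0 := len_gt0 e.
have [Ws|Ws] := pselect (W (src e)); have [Wt|Wt] := pselect (W (tgt e)).
- rewrite (_ : _ @^-1` _ = setT); first exact: openT.
  by apply/seteqP; split => t //= _; case: edge_mapP => // h; left.
- rewrite (_ : _ @^-1` _ = [set t | t < len e]); first exact: open_lt.
  apply/seteqP; split => t /=; case: edge_mapP => //=.
  + by move=> t0 _; exact: le_lt_trans l0.
  + by move=> /andP[].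
  + by rewrite leNgt => /negP.
  + by move=> _ _; left.
- rewrite (_ : _ @^-1` _ = [set t | 0 < t]); first exact: open_gt.
  apply/seteqP; split => t /=; case: edge_mapP => //=.
  + by move=> t0 _; exact: lt_le_trans t0.
  + by move=> /andP[].
  + by rewrite leNgt => /negP.
  + by move=> _ _; right.
- rewrite (_ : _ @^-1` _ = set0); first exact: open0.
  by apply/seteqP; split => t //=; case: edge_mapP => //= _ [].
Qed.

Arguments star_open W : clear implicits.

Lemma edge_interior_open e : open (edge_interior e).
Proof.
rewrite mg_openE => e'; have [->|ee] := pselect (e' = e).
  rewrite (_ : _ @^-1` _ = [set t | 0 < t] `&` [set t | t < len e]).
    by apply: openI; [exact: open_gt|exact: open_lt].
  apply/seteqP; split => t /=; case: edge_mapP => //=.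
  - by move=> /andP[].
  - by rewrite leNgt => /negP t0 [].
  - by rewrite leNgt => /negP t0 [].
rewrite (_ : _ @^-1` _ = set0); first exact: open0.
by apply/seteqP; split => t //=; case: edge_mapP.
Qed.

Arguments edge_interior_open e : clear implicits.

Lemma star_nbhs W p : star W p -> nbhs p (star W).
Proof. by move=> Wp; apply: open_nbhs_nbhs; split => //; exact: star_open. Qed.

Lemma edge_interior_nbhs e p : edge_interior e p -> nbhs p (edge_interior e).
Proof. by move=> ep; apply: open_nbhs_nbhs; split => //; exact: edge_interior_open. Qed.

Lemma edge_map_connected e (I : set R) : is_interval I -> connected (edge_map e @` I).
Proof.
move=> iI; apply: connected_continuous_connected; first exact/connected_intervalP.
exact/continuous_subspaceT/edge_map_continuous.
Qed.

Lemma star_edge_connected W e p : W (src e) -> edge_interior e p ->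
  connected_component (star W) (Vertex (src e)) p.
Proof.
case: p => [//|e' t t_in] We /= ee; subst e'.
apply: (connected_component_max (B := edge_map e @` [set s | s < len e])).
- by exists 0; [exact: len_gt0|rewrite edge_map_src].
- by move=> _ [s /= se <-]; case: edge_mapP => //= [|_]; [rewrite leNgt se|left].
- by apply: edge_map_connected => x y _ ye z /andP[_ zy]; exact: le_lt_trans ye.
- by exists t; [case/andP: (t_in)|rewrite (edge_map_inner t_in)].
Qed.

Lemma star_edge_connected_tgt W e p : W (tgt e) -> edge_interior e p ->
  connected_component (star W) (Vertex (tgt e)) p.
Proof.
case: p => [//|e' t t_in] We /= ee; subst e'.
apply: (connected_component_max (B := edge_map e @` [set s | 0 < s])).
- by exists (len e); [exact: len_gt0|rewrite edge_map_tgt].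
- by move=> _ [s /= se <-]; case: edge_mapP => //= [|_]; [rewrite leNgt se|right].
- by apply: edge_map_connected => x y x0 _ z /andP[xz _]; exact: lt_le_trans xz.
- by exists t; [case/andP: (t_in)|rewrite (edge_map_inner t_in)].
Qed.

Lemma star_connected W x : W x ->
  (forall w, W w -> conn [set e | W (src e) /\ W (tgt e)] x w) -> connected (star W).
Proof.
move=> Wx Wc.
(* The midpoint of an edge links the components of its two end vertices. *)
have mid e : 0 < len e / 2 < len e by have := len_gt0 e; lra.
have cv w : W w -> connected_component (star W) (Vertex x) (Vertex w).
  move=> /Wc[p [pp <-]]; elim: p x Wx {Wc} pp => [x Wx _|w' p ih x Wx /= /andP[xw wp]].
    exact: connected_component_refl.
  move: (xw) => /asboolP[e [/= Ws Wt] ew].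
  have Ww : W w' by case: ew => -[? ?]; subst.
  apply: connected_component_trans (ih _ Ww wp).
  have cs := @star_edge_connected W e (Inner e (mid e)) Ws erefl.
  have ct := @star_edge_connected_tgt W e (Inner e (mid e)) Wt erefl.
  have cst := connected_component_trans cs (connected_component_sym ct).
  by case: ew => -[<- <-] //; exact: connected_component_sym.
suff -> : star W = connected_component (star W) (Vertex x) by exact: component_connected.
apply/seteqP; split; last exact: connected_component_sub.
move=> [w /= Ww|e t te /= [We|We]]; first exact: cv.
- by apply: connected_component_trans (cv _ We) _; exact: star_edge_connected.
- by apply: connected_component_trans (cv _ We) _; exact: star_edge_connected_tgt.
Qed.

Lemma conn_within P x w : conn P x w ->
  conn [set e | conn P x (src e) /\ conn P x (tgt e)] x w.
Proof.
move=> [p [pp <-]]; exists p; split => //.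
suff H u : conn P x u -> path (adj_in P) u p ->
    path (adj_in [set e | conn P x (src e) /\ conn P x (tgt e)]) u p.
  by apply: H pp; exact: conn_refl.
elim: p u {pp} => // w' p ih u xu /= /andP[uw wp].
have xw : conn P x w' by apply: conn_trans xu _; exact: conn_step.
rewrite ih// andbT; move: uw => /asboolP[e Pe ew]; apply/asboolP; exists e => //=.
by case: ew => -[-> ->].
Qed.

(** A boundary vertex lies outside [W] but has a neighbour in [W]. The edge between them joins [W]
    to its complement, so it is one of the early ones; the boundary is therefore finite and
    compact. *)
Lemma boundary_star_sub W n : 
  (forall e, ~ early n e -> (W (src e) <-> W (tgt e))) ->
  boundary (star W) `<=` Vertex @` (src @` early n `|` tgt @` early n).
Proof.
move=> Wn p [cp]; have /interior_id -> := star_open W => np.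
case: p cp np => [w|e t te] cp np.
  have [p] := cp _ (@star_nbhs [set w] (Vertex w) (erefl w)).
  have out e : (src e = w \/ tgt e = w) -> W (src e) \/ W (tgt e) ->
      (Vertex @` (src @` early n `|` tgt @` early n)) (Vertex w).
    move=> ew We; have [en|en] := pselect (early n e).
      by exists w => //; case: ew => ew; [left|right]; exists e.
    have e1 := Wn _ en; move: np => /= nw; exfalso.
    by case: ew => ew; subst w; tauto.
  case: p => [w' [/= Ww ww]|e t te [/= We ew]]; last exact: (out e).
  by subst w'.
have [p [sp ep]] := cp _ (@edge_interior_nbhs e (Inner e te) (erefl e)).
by case: p sp ep => // e' t' te' /= sp ee; subst e'.
Qed.

Lemma incident_finite v : finite_set (incident v).
Proof. exact: locally_finite. Qed.

Lemma conn_isolated n v w : incident v `<=` early n -> conn (~` early n) v w -> w = v.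
Proof.
move=> vn [[|w' p] [/= + lp]]; first by rewrite -lp.
case/andP => /asboolP[e en ew] _; exfalso; apply/en/vn.
by case: ew => -[h1 h2]; [left|right].
Qed.

Lemma components_end (x : nat -> vert G) :
  (forall n, infinite_set (conn (~` early n) (x n))) ->
  (forall n, conn (~` early n.+1) (x n.+1) `<=` conn (~` early n) (x n)) ->
  end_sequence (fun n => star (conn (~` early n) (x n))).
Proof.
move=> infx nest; split.
- move=> n; split.
  + by exists (Vertex (x n)); exact: conn_refl.
  + exact: star_open.
  + apply: (@star_connected _ (x n)); first exact: conn_refl.
    by move=> w; exact: conn_within.
  + apply: finite_compact; apply: (sub_finite_set (@boundary_star_sub _ n _)).
      move=> e en; have := conn_edge (P := ~` early n) en => st.
      by split => h; apply: conn_trans h _; [|exact: conn_sym].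
    by apply: finite_image; rewrite finite_setU; split; apply: finite_image; exact: early_finite.
- by move=> n [w /= /nest//|e t te /= [/nest|/nest]]; [left|right].
apply/seteqP; split => // p pc.
have [w wp] : exists w, star [set w] p.
  by case: p {pc} => [w|e t te]; [exists w|exists (src e); left].
(* Once all edges at [w] and at its neighbours are deleted, these vertices are isolated and cannot
   lie in an infinite component. So the star of [w], a neighbourhood of [p], misses the set of index
   [n]. *)
pose near := incident w `|`
  \bigcup_(e in incident w) (incident (src e) `|` incident (tgt e)).
have [n nn] : exists n, near `<=` early n.
  apply: finite_early; rewrite finite_setU; split; first exact: incident_finite.
  apply: bigcup_finite; first exact: incident_finite.
  by move=> e _; rewrite finite_setU; split; exact: incident_finite.
have out v : incident v `<=` early n -> ~ conn (~` early n) (x n) v.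
  move=> vn xv; apply: (infx n); apply: sub_finite_set (finite_set1 v) => u xu /=.
  by apply: (conn_isolated vn); apply: conn_trans xu; exact: conn_sym.
have ow : ~ conn (~` early n) (x n) w by apply: out => e we; apply: nn; left.
have [q [sq wq]] := pc n I _ (star_nbhs wp).
case: q sq wq => [v /= xv vw|e t te /= xe we].
  by subst v.
have ie : incident w e by case: we => h; [left|right].
case: xe; apply: out => e' h; apply: nn; right; exists e => //; [left|right] => //.
Qed.

Lemma end_of_infinite (S : set (vert G)) : infinite_set S ->
  exists (U : nat -> set (mg_point G)) (x : nat -> vert G), [/\ end_sequence U,
    forall n v, U n (Vertex v) -> conn (~` early n) (x n) v &
    forall n, exists2 s, S s & conn (~` early n) (x n) s].
Proof.
move=> /nested_components[x [infx nest]].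
exists (fun n => star (conn (~` early n) (x n))), x; split => //.
- apply: components_end nest => n; apply: sub_infinite_set (infx n).
  by move=> v [].
- by move=> n; have [s [Ss xs]] := infinite_setN0 (infx n); exists s.
Qed.

End Stars.

Arguments star_open {R G} W.
Arguments edge_interior_open {R G} e.

(** * Rays and topological ends *)

Section Rays.
Context {R : realType} {G : metric_graph R}.
Implicit Types (e : edge G) (u v w x : vert G) (P : set (edge G)) (s t : R)
  (U : set (mg_point G)).

(** Otherwise the connected set [U n] would lie inside a single edge. The decreasing sequence would
    then accumulate in that compact edge, against the empty intersection of the closures. *)
Lemma vertex_in_end_sequence (U : nat -> set (mg_point G)) n :
  end_sequence U -> exists v, U n (Vertex v).
Proof.
move=> [Un Us Ucap]; apply: contrapT => /forallNP nov.
have [[p Unp] oU cU _] := Un n.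
have mono m k : (m <= k)%N -> U k `<=` U m.
  by move=> mk; rewrite -(subnK mk); elim: (k - m)%N => // i ih; rewrite addSn => q /Us/ih.
case: p Unp => [v /nov//|e t te Unp].
have sub : U n `<=` edge_interior e.
  suff <- : U n `&` edge_interior e = U n by exact: subIsetr.
  apply: cU.
  - by exists (Inner e te).
  - by exists (edge_interior e) => //; exact: edge_interior_open.
  - exists (~` \bigcup_(e' in [set e' | e' <> e]) edge_interior e').
      by apply: open_closedC; apply: bigcup_open => e' _; exact: edge_interior_open.
    apply/seteqP; split => -[v|e' t' te'] [Uq /=] //.
    + by move=> ee; split => // -[e'' /= ne ee']; apply: ne; rewrite -ee' ee.
    + by move=> _; have /nov := Uq.
    + by move=> ne; split => //=; apply: contrapT => ee; apply: ne; exists e'.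
(* The index [maxn m n] keeps the chosen points in [U n], hence on the edge [e], also for small
   [m]. *)
have pick m : {r : R | r \in `[0, len e] & U (maxn m n) (edge_map e r)}.
  apply: cid2; have [[q Uq] _ _ _] := Un (maxn m n).
  have := sub _ (mono _ _ (leq_maxr m n) _ Uq).
  case: q Uq => //= e' r re Uq ee; subst e'; exists r.
    by case/andP: (re) => r0 rl; rewrite in_itv/= !ltW.
  by rewrite (edge_map_inner re).
pose r m := s2val (pick m).
have [|r0 [r0I r0c]] := @segment_compact R 0 (len e) (r @ \oo) _ _.
  by exists 0%N => // m _ /=; exact: (s2valP (pick m)).
suff : (\bigcap_m closure (U m)) (edge_map e r0) by rewrite Ucap.
move=> m _; have cl : closed (edge_map e @^-1` closure (U m)).
  by apply: (continuous_closedP _).1; [exact: edge_map_continuous|exact: closed_closure].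
apply: cl => B /r0c; apply => //.
exists m => // k /= mk; apply: subset_closure.
exact: (mono m _ (leq_trans mk (leq_maxl _ _))) (s2valP' (pick k)).
Qed.

Definition edges_in U : set (edge G) := [set e | forall t, U (edge_map e t)].

(** For points of edges that need not be contained in [U]: one endpoint is joined to [u], and the
    segment towards it stays in [U]. As [edge_map] is constant beyond the endpoints, the half-line
    of parameters describes exactly that segment, endpoint included. *)
Let reached U u e t :=
  (conn (edges_in U) u (src e) /\ forall s, s <= t -> U (edge_map e s)) \/
  (conn (edges_in U) u (tgt e) /\ forall s, t <= s -> U (edge_map e s)).

Let reached_near U u e t t' r : (forall s, `|s - t| < r -> U (edge_map e s)) ->
  `|t' - t| < r -> reached U u e t <-> reached U u e t'.
Proof.
move=> Ur; rewrite ltr_norml => /andP[t1 t2].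
by split => -[[c h]|[c h]]; [left|right|left|right]; split => // s st;
  have [h1|h1] := leP t t'; have [h2|h2] := leP s t; have [h3|h3] := leP s t';
  first [by apply: h; lra|apply: Ur; rewrite ltr_norml; apply/andP; split; lra].
Qed.

(* The points of [U] that are joined to the vertex [u] inside [U] form a
   relatively clopen subset. *)
Lemma open_connected_conn U u v : open U -> connected U ->
  U (Vertex u) -> U (Vertex v) -> conn (edges_in U) u v.
Proof.
move=> oU cU Uu Uv.
pose A : set (mg_point G) := fun p => match p with
  | Vertex w => conn (edges_in U) u w
  | Inner e t _ => reached U u e t
  end.
(* The two descriptions agree at an endpoint: reaching it from the opposite end traverses the whole
   closed edge, which therefore belongs to [edges_in U]. *)
have AE e t : U (edge_map e t) -> A (edge_map e t) <-> reached U u e t.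
  case: edge_mapP => [t0|te|//] Uw /=.
  - split=> [c|[[]//|[c h]]].
      by left; split => // s st; rewrite edge_map_src// (le_trans st).
    apply: conn_trans c _; apply/conn_sym/conn_edge => s.
    by have [/h//|/ltW st] := leP t s; rewrite edge_map_src// (le_trans st).
  - split=> [c|[[c h]|[]//]].
      by right; split => // s st; rewrite edge_map_tgt// (le_trans te).
    apply: conn_trans c _; apply/conn_edge => s.
    by have [/h//|/ltW st] := leP s t; rewrite edge_map_tgt// (le_trans te).
have loc e t : U (edge_map e t) -> exists2 r, 0 < r &
    forall s, `|s - t| < r -> U (edge_map e s).
  move=> Ut; have /nbhs_ballP[r /= r0 H] : nbhs t (edge_map e @^-1` U).
    by apply: open_nbhs_nbhs; split => //; exact: oU.
  by exists r => // s st; apply: H; rewrite /ball /= distrC.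
have oUA : open (U `&` A).
  rewrite mg_openE => e; rewrite openE => t [/= Ut /(AE _ _ Ut) Qt].
  have [r r0 Ur] := loc e t Ut; exists r => // s; rewrite /ball /= distrC => sr.
  by split => /=; [exact: Ur|apply/(AE _ _ (Ur _ sr)); apply/(reached_near u Ur sr)].
have oUN : open (U `&` ~` A).
  rewrite mg_openE => e; rewrite openE => t [/= Ut nA].
  have [r r0 Ur] := loc e t Ut; exists r => // s; rewrite /ball /= distrC => sr.
  split => /=; first exact: Ur.
  by move=> /(AE _ _ (Ur _ sr)) /(reached_near u Ur sr) /(AE _ _ Ut).
suff UA : U `&` A = U by have [_ Av] : (U `&` A) (Vertex v) by rewrite UA.
apply: cU.
- by exists (Vertex u); split => //; exact: conn_refl.
- by exists (U `&` A) => //; rewrite setIA setIid.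
- exists (~` (U `&` ~` A)); first exact: open_closedC.
  apply/seteqP; split => p [Up h]; split => //; first by move=> [].
  by apply: contrapT => nA; apply: h.
Qed.

(** Loop erasure: from each vertex jump to the time of its last visit, which exists because the walk
    finally leaves every vertex, then take one step. Later vertices differ from all earlier ones. *)
Lemma ray_of_walk (w : nat -> vert G) :
  (forall k, w k.+1 = w k \/ mg_adj (w k) (w k.+1)) ->
  (forall v, exists K, forall k, (K <= k)%N -> w k <> v) ->
  exists r, ray r /\ exists2 t : nat -> nat, (forall n, (n <= t n)%N) &
    forall n, r n = w (t n).
Proof.
move=> ww wf.
have last_visit k : {t : nat | (k <= t)%N & w t = w k /\ forall s : nat, (t < s)%N -> w s <> w k}.
  apply: cid2; have [K HK] := wf (w k).
  have exP : exists t : nat, (k <= t)%N && (w t == w k) by exists k; rewrite leqnn eqxx.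
  have ubP (t : nat) : (k <= t)%N && (w t == w k) -> (t <= K)%N.
    by move=> /andP[_ /eqP tk]; rewrite leqNgt; apply/negP => /ltnW /HK.
  have [t /andP[kt /eqP tk] tmax] := ex_maxnP exP ubP.
  exists t => //; split => // s ts sk.
  have /tmax : (k <= s)%N && (w s == w k) by rewrite sk eqxx (leq_trans kt (ltnW ts)).
  by rewrite leqNgt ts.
pose L k := s2val (last_visit k).
have Lk k : (k <= L k)%N := s2valP (last_visit k).
have Lw k : w (L k) = w k := (s2valP' (last_visit k)).1.
have Ls k (s : nat) : (L k < s)%N -> w s <> w k := (s2valP' (last_visit k)).2 s.
have [t [t0 tSE]] : exists t : nat -> nat, t 0%N = L 0%N /\ forall n, t n.+1 = L (t n).+1.
  by exists (nat_rect (fun=> nat) (L 0%N) (fun _ k => L k.+1)).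
have tL n : exists k, t n = L k.
  by case: n => [|n]; [exists 0%N; exact: t0|exists (t n).+1; exact: tSE].
have tS n : (t n < t n.+1)%N by rewrite tSE; exact: Lk.
have tmono n m : (n < m)%N -> (t n < t m)%N.
  by move=> nm; apply: (homo_ltn ltn_trans tS).
have tlast n (s : nat) : (t n < s)%N -> w s <> w (t n).
  by have [k ->] := tL n; rewrite Lw; exact: Ls.
exists (w \o t); split; last first.
  exists t => // n; elim: n => // n ih; exact: leq_ltn_trans (tS n).
split.
  by move=> n m /= e; case: (ltngtP n m) => // /tmono/tlast; rewrite e.
move=> n /=; rewrite tSE Lw.
have [e|//] := ww (t n).
by have := tlast n (t n).+1 (ltnSn _).
Qed.

(** Concatenate paths inside [U n] leading to a vertex of [U n.+1]. The resulting walk is eventually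
    in every [U n]; since each vertex is outside the closure of some [U n], the walk finally leaves
    it, and loop erasure applies. *)
Lemma end_sequence_ray (U : nat -> set (mg_point G)) : end_sequence U ->
  exists r, ray r /\ forall n, exists K, forall k, (K <= k)%N -> U n (Vertex (r k)).
Proof.
move=> Uend; have [Un Us Ucap] := Uend.
have mono m k : (m <= k)%N -> U k `<=` U m.
  by move=> mk; rewrite -(subnK mk); elim: (k - m)%N => // i ih; rewrite addSn => q /Us/ih.
have pth n x : {p | U n (Vertex x) ->
    path (adj_in (edges_in (U n))) x p /\ U n.+1 (Vertex (last x p))}.
  apply: cid; have [Ux|] := pselect (U n (Vertex x)); last by exists [::].
  have [z Uz] := vertex_in_end_sequence n.+1 Uend.
  have [_ oU cU _] := Un n.
  have [p [pp lp]] := open_connected_conn oU cU Ux (Us _ _ Uz).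
  by exists p => _; rewrite lp.
(* A state consists of the index of the current set, the current vertex and the rest of the path to
   the next set. When the path is used up the index grows while the vertex stays, which is why
   [ray_of_walk] allows pauses. *)
pose step (s : nat * vert G * seq (vert G)) : nat * vert G * seq (vert G) :=
  match s with
  | (n, x, y :: p) => (n, y, p)
  | (n, x, [::]) => (n.+1, x, sval (pth n.+1 x))
  end.
pose inv (s : nat * vert G * seq (vert G)) := [/\ U s.1.1 (Vertex s.1.2),
  path (adj_in (edges_in (U s.1.1))) s.1.2 s.2 & U s.1.1.+1 (Vertex (last s.1.2 s.2))].
have inv_step (s : nat * vert G * seq (vert G)) : inv s -> inv (step s).
  case: s => [[n x] [|y p]] [/= Ux pp lp]; last first.
    move: pp => /andP[/asboolP[e eU ey] pp]; split => //=.
    by case: ey => -[h1 h2]; [rewrite -h2 -(edge_map_tgt (lexx (len e)))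
      |rewrite -h1 -(edge_map_src e (lexx 0))]; exact: eU.
  by have [h1 h2] := svalP (pth n.+1 x) lp; split.
have [x0 Ux0] := vertex_in_end_sequence 0 Uend.
pose st k := iter k step (0%N, x0, sval (pth 0%N x0)).
have inv_st k : inv (st k).
  elim: k => [|k ih]; last exact: inv_step.
  by have [h1 h2] := svalP (pth 0%N x0) Ux0.
pose w k := (st k).1.2; pose stage k := (st k).1.1.
have stageS k : (stage k <= stage k.+1)%N.
  by rewrite /stage /st iterS; case: (iter k _ _) => [[n x] [|y p]] /=.
have stage_mono k m : (k <= m)%N -> (stage k <= stage m)%N.
  by move=> km; apply: (homo_leq leqnn leq_trans stageS).
have stage_next k : exists m, (stage k < stage m)%N.
  have : exists p, (st k).2 = p by exists (st k).2.
  move=> [p]; elim: p k => [|y p ih] k kp.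
    exists k.+1; rewrite /stage /st iterS -/(st k).
    by case: (st k) kp => [[n x] q] /= ->.
  have [|m km] := ih k.+1.
    by rewrite /st iterS -/(st k); case: (st k) kp => [[n x] q] /= ->.
  by exists m; exact: leq_ltn_trans (stageS k) km.
have stage_unbounded N : exists k, (N <= stage k)%N.
  elim: N => [|N [k ih]]; first by exists 0%N.
  by have [m km] := stage_next k; exists m; exact: leq_ltn_trans km.
have wU n : exists K, forall k, (K <= k)%N -> U n (Vertex (w k)).
  have [K nK] := stage_unbounded n; exists K => k Kk.
  have [Uw _ _] := inv_st k.
  by apply: mono Uw; exact: leq_trans (stage_mono _ _ Kk).
have [||r [rr [t tn rt]]] := @ray_of_walk w.
- move=> k; rewrite /w /st iterS -/(st k).
  have [Ux pp _] := inv_st k; case: (st k) Ux pp => [[n x] [|y p]] /=; first by left.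
  by move=> _ /andP[/adj_in_mg xy _]; right.
- move=> v; have [n nv] : exists n, ~ closure (U n) (Vertex v).
    apply: contrapT => /forallNP h.
    suff : (\bigcap_n closure (U n)) (Vertex v) by rewrite Ucap.
    by move=> n _; exact: contrapT (h n).
  have [K KU] := wU n; exists K => k /KU Uw vw.
  by apply: nv; apply: subset_closure; rewrite -vw.
exists r; split => // n; have [K KU] := wU n; exists K => k Kk.
by rewrite rt; apply: KU; exact: leq_trans (tn k).
Qed.

Lemma ray_shift (r : nat -> vert G) K : ray r -> ray (fun k => r (K + k)%N).
Proof.
move=> [ri ra]; split; first by move=> i j /ri/addnI.
by move=> k; rewrite addnS; exact: ra.
Qed.

Lemma ray_equiv_shift (r : nat -> vert G) K : ray r -> ray_equiv r (fun k => r (K + k)%N).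
Proof.
move=> rr; have [ri _] := rr.
have inf (f : nat -> nat) : injective f -> infinite_set (range (r \o f)).
  move=> fi fin; apply: infinite_nat.
  apply: (@sub_finite_set _ _ ((r \o f) @^-1` range (r \o f))); first by move=> n _; exists n.
  by apply: finite_preimage fin => i k _ _ /ri/fi.
exists r; split => //.
  by rewrite setIid; exact: (inf id).
have := inf (addn K) (@addnI K); apply: sub_infinite_set.
by move=> _ [k _ <-]; split; [exists (K + k)%N|exists k].
Qed.

(** Every tail of the ray is equivalent to the ray itself, so a tail contained in the given set is
    the required member of the graph end. *)
Lemma topological_end_corresp (gamma : set (nat -> set (mg_point G))) :
  topological_ends G gamma -> exists o, end_corresp gamma o.
Proof.
move=> [U [Uend ->]]; have [r [rr rU]] := end_sequence_ray Uend.
exists [set r' | ray r' /\ ray_equiv r r']; split; first by exists r.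
move=> U' [_ UU'] n; have [j [k [_ kn]]] := UU' n.
have [K KU] := rU k; exists (fun i => r (K + i)%N).
  by split; [exact: ray_shift|exact: ray_equiv_shift].
by move=> i; apply: kn; apply: KU; exact: leq_addr.
Qed.

End Rays.

(** * Complex-valued functions *)

Section ComplexEdge.
Context {R : realType}.
Local Notation mu := (@lebesgue_measure R).
Implicit Types (u v g h : R -> R[i]) (L x : R) (z : R[i]).

Definition repart u : R -> R := fun x => complex.Re (u x).
Definition impart u : R -> R := fun x => complex.Im (u x).

Lemma abs2_ge0 z : 0 <= abs2 z.
Proof. by rewrite addr_ge0// sqr_ge0. Qed.

Lemma L2_intervalP L u :
  L2_interval L u <-> sqint 0 L (repart u) /\ sqint 0 L (impart u).
Proof.
split=> [[mr mi fin]|[[mr ir] [mi ii]]].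
  have ma : measurable_fun `[0, L] (fun x => abs2 (u x)).
    by apply: measurable_funD; exact: measurable_funX.
  have ai : integ 0 L (fun x => abs2 (u x)).
    apply/integrableP; split; first exact/measurable_EFinP.
    apply: le_lt_trans fin; rewrite /L2sq.
    by under eq_integral do rewrite /= ger0_norm ?abs2_ge0//.
  split; split => //; apply: (integ_le _ ai); try exact: measurable_funX.
    by move=> x _; rewrite ger0_norm ?sqr_ge0// lerDl sqr_ge0.
  by move=> x _; rewrite ger0_norm ?sqr_ge0// lerDr sqr_ge0.
split => //; have /integrableP[_] := integD ir ii.
apply: le_lt_trans; rewrite /L2sq le_eqVlt; apply/orP; left; apply/eqP.
by apply: eq_integral => x _ /=; rewrite ger0_norm// addr_ge0// sqr_ge0.
Qed.

Lemma L2sqE L u : L2_interval L u ->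
  L2sq L u = (\int[mu]_(t in `[0, L]) (repart u t ^+ 2) +
              \int[mu]_(t in `[0, L]) (impart u t ^+ 2))%:E.
Proof.
move=> /L2_intervalP[[_ ir] [_ ii]]; rewrite -RintD// /Rintegral fineK//.
by apply: integrable_fin_num => //; exact: (integD ir ii).
Qed.

Lemma is_wderivP L u g : is_wderiv L u g <->
  h1 L (repart u) (repart g) /\ h1 L (impart u) (impart g).
Proof.
split=> [[/L2_intervalP[gr gi] uE]|[[gr ur] [gi ui]]].
  by split; split => // x /uE; rewrite /repart /impart => ->; case: (u 0).
split; first exact/L2_intervalP.
move=> x xL; apply/eqP; rewrite eq_complex; apply/andP; split; apply/eqP.
  by have := ur x xL; rewrite /repart => ->; case: (u 0).
by have := ui x xL; rewrite /impart => ->; case: (u 0).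
Qed.

Lemma wderivP L u : H1_interval L u -> is_wderiv L u (wderiv L u).
Proof. by move=> [_ [g ug]]; apply: (xgetPex (fun=> 0)); exists g. Qed.

(** Uniqueness almost everywhere lets an explicit derivative replace the one picked by choice in
    [wderiv]. *)
Lemma L2sq_wderiv L u g : is_wderiv L u g -> L2sq L (wderiv L u) = L2sq L g.
Proof.
move=> ug; have : is_wderiv L u (wderiv L u) by apply: (xgetPex (fun=> 0)); exists g.
move: ug; set k := wderiv L u => ug uk.
have [/L2_intervalP[[mgr _] [mgi _]] _] := ug; have [/L2_intervalP[[mkr _] [mki _]] _] := uk.
have {ug}[gr gi] := (is_wderivP _ _ _).1 ug; have {uk}[kr ki] := (is_wderivP _ _ _).1 uk.
apply: ae_eq_integral => //.
- by apply/measurable_EFinP; apply: measurable_funD; exact: measurable_funX.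
- by apply/measurable_EFinP; apply: measurable_funD; exact: measurable_funX.
have := h1_derivative_unique kr gr; have := h1_derivative_unique ki gi.
apply: filterS2; first exact: (ae_filter_ringOfSetsType mu).
move=> x /= xi xr xL; congr EFin; rewrite /abs2.
by move: (xi xL) (xr xL); rewrite /repart /impart => -> ->.
Qed.

Definition cenergy L u : \bar R := (L2sq L u + L2sq L (wderiv L u))%E.

Lemma cenergy_ge0 L u : (0 <= cenergy L u)%E.
Proof.
by apply: adde_ge0; apply: integral_ge0 => x _; rewrite lee_fin abs2_ge0.
Qed.

Lemma cenergyE L u g : L2_interval L u -> is_wderiv L u g ->
  cenergy L u = (energy L (repart u) (repart g) + energy L (impart u) (impart g))%:E.
Proof.
move=> u2 ug; rewrite /cenergy (L2sq_wderiv ug) !L2sqE//; last by case: ug.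
by rewrite -EFinD /energy; congr EFin; ring.
Qed.

Lemma is_wderivB L u v g h : is_wderiv L u g -> is_wderiv L v h ->
  is_wderiv L (fun x => u x - v x) (fun x => g x - h x).
Proof.
move=> /is_wderivP[ur ui] /is_wderivP[vr vi]; apply/is_wderivP; split.
  have := h1B ur vr; rewrite /repart.
  by under eq_fun do rewrite -raddfB; under [X in h1 _ _ X]eq_fun do rewrite -raddfB.
have := h1B ui vi; rewrite /impart.
by under eq_fun do rewrite -raddfB; under [X in h1 _ _ X]eq_fun do rewrite -raddfB.
Qed.

Lemma is_wderiv_L2 L u g : 0 <= L -> is_wderiv L u g -> L2_interval L u.
Proof.
move=> L0 /is_wderivP[ur ui]; apply/L2_intervalP.
by split; [exact: h1_sqint ur|exact: h1_sqint ui].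
Qed.

Lemma H1_intervalB L u v : 0 <= L -> H1_interval L u -> H1_interval L v ->
  H1_interval L (fun x => u x - v x).
Proof.
move=> L0 /wderivP ud /wderivP vd; have d := is_wderivB ud vd.
by split; [exact: is_wderiv_L2 d|eexists; exact: d].
Qed.

Lemma cenergy_osc L u x y : H1_interval L u -> x \in `[0, L] -> y \in `[0, L] ->
  (`|abs2 (u y) - abs2 (u x)|%:E <= cenergy L u)%E.
Proof.
move=> uH xL yL; have ud := wderivP uH; rewrite (cenergyE uH.1 ud) lee_fin.
have [ur ui] := (is_wderivP _ _ _).1 ud.
have h1 := h1_osc ur xL yL; have h2 := h1_osc ui xL yL.
have -> : abs2 (u y) - abs2 (u x) = (repart u y ^+ 2 - repart u x ^+ 2)
   + (impart u y ^+ 2 - impart u x ^+ 2) by rewrite /abs2 /repart /impart; ring.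
by rewrite (le_trans (ler_normD _ _))// lerD.
Qed.

Lemma cenergy_end L u x : 0 < L -> H1_interval L u -> x \in `[0, L] ->
  ((abs2 (u x))%:E <= (L^-1 + 1)%:E * cenergy L u)%E.
Proof.
move=> L0 uH xL; have ud := wderivP uH; rewrite (cenergyE uH.1 ud) -EFinM lee_fin.
have [ur ui] := (is_wderivP _ _ _).1 ud.
have := h1_end ur xL; have := h1_end ui xL; rewrite -(ler_pM2l L0) /abs2 => e1 e2.
set A := energy _ _ _ in e1 *; set B := energy _ _ _ in e2 *.
have -> : L * ((L^-1 + 1) * (B + A)) = (1 + L) * (B + A) by field; rewrite gt_eqF.
move: e1 e2; rewrite /repart /impart; lra.
Qed.

Lemma normc_abs2 z : `|z| = (Num.sqrt (abs2 z))%:C%C.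
Proof. by rewrite normc_def. Qed.

End ComplexEdge.

(** * Vertex values and limits along rays *)

Section VanishingAtEnds.
Context {R : realType} {G : metric_graph R}.
Implicit Types (f g h : mg_point G -> R[i]^o) (e : edge G) (v : vert G).

Definition edge_energy f e : \bar R := cenergy (len e) (edge_fun f e).

Lemma edge_fun_src f e : edge_fun f e 0 = f (Vertex (src e)).
Proof. by rewrite /edge_fun edge_map_src. Qed.

Lemma edge_fun_tgt f e : edge_fun f e (len e) = f (Vertex (tgt e)).
Proof. by rewrite /edge_fun edge_map_tgt. Qed.

Lemma H1norm_sqE f : H1norm_sq f = (\esum_(e in [set: edge G]) edge_energy f e)%E.
Proof.
by rewrite /H1norm_sq esumD// => e _; apply: integral_ge0 => x _; rewrite lee_fin abs2_ge0.
Qed.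

Lemma edge_energy_ge0 f e : (0 <= edge_energy f e)%E.
Proof. exact: cenergy_ge0. Qed.

Lemma mem0_len e : 0 \in `[0, len e].
Proof. by rewrite in_itv/= lexx ltW// len_gt0. Qed.

Lemma mem_len e : len e \in `[0, len e].
Proof. by rewrite in_itv/= lexx ltW// len_gt0. Qed.

Lemma edge_energy_osc f e : H1_interval (len e) (edge_fun f e) ->
  (`|abs2 (f (Vertex (tgt e))) - abs2 (f (Vertex (src e)))|%:E <= edge_energy f e)%E.
Proof.
move=> fe; rewrite -edge_fun_src -edge_fun_tgt.
by apply: cenergy_osc => //; [exact: mem0_len|exact: mem_len].
Qed.

Lemma conn_osc P f u v : (forall e, H1_interval (len e) (edge_fun f e)) -> conn P u v ->
  (`|abs2 (f (Vertex u)) - abs2 (f (Vertex v))|%:E <= \esum_(e in P) edge_energy f e)%E.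
Proof.
move=> fH; apply: (conn_energy (h := fun v => abs2 (f (Vertex v)))).
  exact: edge_energy_ge0.
by move=> e _; exact: edge_energy_osc.
Qed.

(** The bound from a single edge degenerates as its length tends to 0, so it is used on one fixed
    edge [e0] only; a path carries it to the other vertices at the price of one more energy. This
    makes [C] uniform. *)
Lemma vertex_bound : exists2 C : R, 0 < C & forall f,
  (forall e, H1_interval (len e) (edge_fun f e)) -> forall v,
  ((abs2 (f (Vertex v)))%:E <= C%:E * H1norm_sq f)%E.
Proof.
have [e0 _] : [set: edge G] !=set0 by apply: infinite_setN0; exact: edge_infinite.
have l0 : 0 < (len e0)^-1 by rewrite invr_gt0 len_gt0.
exists ((len e0)^-1 + 1 + 1); first by lra.
move=> f fH v; rewrite H1norm_sqE.
set H := esum _ _; have H0 : (0 <= H)%E by apply: esum_ge0 => e _; exact: edge_energy_ge0.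
have e1 : (edge_energy f e0 <= H)%E.
  rewrite -[leLHS](@esum_set1 _ _ e0 (edge_energy f)); last exact: edge_energy_ge0.
  rewrite /H (esumID [set e0] setT); last by move=> *; exact: edge_energy_ge0.
  rewrite setTI leeDl// esum_ge0// => *; exact: edge_energy_ge0.
have b0 : ((abs2 (f (Vertex (src e0))))%:E <= ((len e0)^-1 + 1)%:E * H)%E.
  rewrite -edge_fun_src (le_trans (cenergy_end (len_gt0 e0) (fH e0) (mem0_len e0)))//.
  by apply: lee_wpmul2l => //; rewrite lee_fin; lra.
have o0 := conn_osc fH (connT v (src e0)).
have -> : (((len e0)^-1 + 1 + 1)%:E * H = ((len e0)^-1 + 1)%:E * H + H)%E.
  rewrite [in LHS]EFinD. rewrite ge0_muleDl ?mul1e// lee_fin; lra.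
rewrite (le_trans _ (leeD b0 o0))// -EFinD lee_fin.
by have := ler_norm (abs2 (f (Vertex v)) - abs2 (f (Vertex (src e0)))); lra.
Qed.

Lemma H2_finite_eventually0 g (r : nat -> vert G) : H2_finite_kirchhoff g -> ray r ->
  exists K, forall k, (K <= k)%N -> g (Vertex (r k)) = 0.
Proof.
move=> [_ fin _ _] [ri ra].
set S := [set e | _] in fin.
have finV : finite_set (src @` S `|` tgt @` S).
  by rewrite finite_setU; split; exact: finite_image.
have := finite_preimage (f := r) (B := src @` S `|` tgt @` S) _ finV.
move=> /(_ (fun i j _ _ => @ri i j)) /finite_seqP[s sE].
exists (\max_(i <- s) i.+1)%N => k sk; apply: contrapT => /eqP gk.
have /asboolP[e ek] := ra k.
(* A nonzero value at [r k] puts the edge from [r k] to [r k.+1] into the support, so [k] is one of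
   finitely many indices. *)
have : (r @^-1` (src @` S `|` tgt @` S)) k.
  case: ek => -[h1 h2]; [left|right]; exists e => //.
    by exists 0; [exact: mem0_len|rewrite edge_fun_src h1].
  by exists (len e); [exact: mem_len|rewrite edge_fun_tgt h2].
rewrite sE /= => ks; have := @leq_bigmax_seq _ s xpredT (fun i => i.+1) k ks isT.
by move=> /(leq_trans)/(_ sk); rewrite ltnn.
Qed.

Lemma cvg0_abs2 (z : nat -> R[i]^o) :
  (forall eps : R, 0 < eps -> \forall n \near \oo, abs2 (z n) < eps) ->
  z @ \oo --> (0 : R[i]^o).
Proof.
move=> zP; apply/cvgrPdist_lt => eps.
rewrite ltcE /= => /andP[/eqP ei er].
have er2 : 0 < complex.Re eps ^+ 2 by exact: exprn_gt0.
apply: filterS (zP _ er2) => n zn.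
rewrite sub0r normrN normc_abs2 ltcE /= -ei eqxx /=.
by rewrite -[ltRHS](gtr0_norm er) -sqrtr_sqr ltr_sqrt.
Qed.

Lemma H1_0_boundary f : H1_0 G f ->
  forall gamma, topological_ends G gamma -> boundary_value f gamma 0.
Proof.
move=> [[_ _ fH _] fapp] gamma /topological_end_corresp[om go]; exists om => //.
move=> r omr; have rr : ray r.
  by have [[r0 [_ omE]] _] := go; move: omr; rewrite omE => -[].
apply: cvg0_abs2 => eps eps0.
have [C C0 CP] := vertex_bound.
(* With this tolerance, [C] times the squared H^1 distance is below [eps]. *)
have [|g gK gf] := fapp (Num.sqrt (eps / C)); first by rewrite sqrtr_gt0 divr_gt0.
have [K KP] := H2_finite_eventually0 gK rr.
exists K => // k /KP gk0.
have hH e : H1_interval (len e) (edge_fun (f \- g)%R e).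
  apply: H1_intervalB; [exact/ltW/len_gt0|exact: fH|].
  by have [_ _ /(_ e)[]] := gK.
have := CP _ hH (r k); rewrite /= gk0 subr0 => h.
rewrite -lte_fin (le_lt_trans h)//.
rewrite sqr_sqrtr in gf; last by rewrite divr_ge0 ?ltW.
by rewrite muleC -lte_pdivlMr// -EFinM.
Qed.

End VanishingAtEnds.

(** * Flat functions on an edge, real and complex *)

Section FlatFunctions.
Context {R : realType}.
Local Notation mu := (@lebesgue_measure R).
Implicit Types (L x y t : R).

(** [phi] is Lipschitz and vanishes at both ends, so [p] deviates from its end values only
    quadratically. The linear bound serves continuity, the quadratic ones the zero outer
    derivatives. *)
Lemma flat_bounds L (p phi psi : R -> R) : 0 < L -> flat L p phi psi ->
  exists2 K, 0 <= K & forall x y, 0 <= x -> x <= y -> y <= L ->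
    [/\ `|p y - p x| <= K * (y - x), `|p y - p 0| <= K * y ^+ 2 &
        `|p L - p x| <= K * (L - x) ^+ 2].
Proof.
move=> L0 [cpsi hphi hp p0 pL].
have [M M0 psiM] : exists2 M, 0 <= M & forall x, x \in `[0, L] -> `|psi x| <= M.
  have cn : {within `[0, L], continuous (fun x => `|psi x|)}.
    apply: continuous_subspaceT => x.
    by apply: (continuous_comp (cpsi x)); exact: norm_continuous.
  have [c cI cmax] := EVT_max (ltW L0) cn.
  by exists `|psi c|.
have bnd (h k : R -> R) N a b : h1 L h k -> 0 <= a -> a <= b -> b <= L ->
    (forall x, x \in `[a, b] -> `|k x| <= N) -> `|h b - h a| <= N * (b - a).
  move=> hk a0 ab bL kN; rewrite (le_trans (h1_dist hk a0 ab bL))// -Rint_cst//.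
  apply: le_Rint; [|exact: integ_cst|exact: kN].
  by apply: integ_norm; apply: integ_sub (sqint_integ hk.1) _ _.
have phi0 x : 0 <= x -> x <= L -> `|phi x| <= M * x.
  move=> x0 xL; have := bnd _ _ M 0 x hphi (lexx 0) x0 xL.
  rewrite p0 !subr0; apply => z; rewrite in_itv/= => /andP[z0 zx].
  by apply: psiM; rewrite in_itv/= z0 (le_trans zx).
have phiL x : 0 <= x -> x <= L -> `|phi x| <= M * (L - x).
  move=> x0 xL; have := bnd _ _ M x L hphi x0 xL (lexx L).
  rewrite pL sub0r normrN; apply => z; rewrite in_itv/= => /andP[xz zL].
  by apply: psiM; rewrite in_itv/= zL andbT (le_trans x0).
exists (M * L + M); first by rewrite addr_ge0// mulr_ge0// ltW.
move=> x y x0 xy yL; have xL := le_trans xy yL; have y0 := le_trans x0 xy.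
have le1 a b : 0 <= a -> M * a <= M * b -> M * a * a <= M * b * a.
  by move=> a0 ab; exact: ler_wpM2r.
split.
- apply: (le_trans (bnd _ _ (M * L) x y hp x0 xy yL _)).
    move=> z; rewrite in_itv/= => /andP[xz zy].
    rewrite (le_trans (phi0 z _ _))//; [lra|lra|by rewrite ler_wpM2l//; lra].
  by rewrite ler_wpM2r ?subr_ge0// lerDl.
- apply: (le_trans (bnd _ _ (M * y) 0 y hp (lexx 0) y0 yL _)).
    move=> z; rewrite in_itv/= => /andP[z0 zy].
    by rewrite (le_trans (phi0 z z0 (le_trans zy yL)))// ler_wpM2l.
  rewrite subr0; have -> : (M * L + M) * y ^+ 2 = M * L * y ^+ 2 + M * y * y by ring.
  by rewrite lerDr mulr_ge0 ?sqr_ge0// mulr_ge0// ltW.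
- apply: (le_trans (bnd _ _ (M * (L - x)) x L hp x0 xL (lexx L) _)).
    move=> z; rewrite in_itv/= => /andP[xz zL].
    rewrite (le_trans (phiL z (le_trans x0 xz) zL))// ler_wpM2l//; lra.
  have -> : (M * L + M) * (L - x) ^+ 2 = M * L * (L - x) ^+ 2 + M * (L - x) * (L - x) by ring.
  by rewrite lerDr mulr_ge0 ?sqr_ge0// mulr_ge0// ltW.
Qed.

Definition cflat L (p : R -> R[i]) :=
  (exists phi psi, flat L (repart p) phi psi) /\
  (exists phi psi, flat L (impart p) phi psi).

Lemma h1_ext L (u v g : R -> R) : 0 <= L -> (forall x, x \in `[0, L] -> u x = v x) ->
  h1 L u g -> h1 L v g.
Proof.
move=> L0 uv [gi uE]; split => // x xL; rewrite -uv// uE// -(uv 0)// in_itv/= lexx//.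
Qed.

Lemma cflat_ext L (p q : R -> R[i]) : 0 <= L -> (forall x, x \in `[0, L] -> p x = q x) ->
  cflat L p -> cflat L q.
Proof.
move=> L0 pq [[a [b [h1 h2 h3 h4 h5]]] [c [d [k1 k2 k3 k4 k5]]]].
split; [exists a, b|exists c, d]; split => //.
  by apply: h1_ext h3 => // x xL; rewrite /repart pq.
by apply: h1_ext k3 => // x xL; rewrite /impart pq.
Qed.

Lemma cflat_H2 L (p : R -> R[i]) : 0 <= L -> cflat L p -> H2_interval L p.
Proof.
move=> L0 [[a [b [cb hab hpa _ _]]] [c [d [cd hcd hpc _ _]]]].
have d1 : is_wderiv L p (fun x => (a x +i* c x)%C) by apply/is_wderivP.
have d2 : is_wderiv L (fun x => (a x +i* c x)%C) (fun x => (b x +i* d x)%C) by apply/is_wderivP.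
split; first by split; [exact: is_wderiv_L2 d1|eexists; exact: d1].
by eexists; split; [exact: d1|split; [exact: is_wderiv_L2 d2|eexists; exact: d2]].
Qed.

Lemma gt0_complex (z : R[i]) : 0 < z -> exists2 r : R, 0 < r & z = r%:C%C.
Proof. by case: z => a b; rewrite ltcE /= => /andP[/eqP -> a0]; exists a. Qed.

Lemma normc_le (z : R[i]) (b : R) : `|complex.Re z| <= b -> `|complex.Im z| <= b ->
  `|z| <= (2 * b)%:C%C.
Proof.
move=> rb ib; have b0 : 0 <= b by exact: le_trans rb.
rewrite normc_abs2 lecR -(@ger0_norm _ (2 * b)); last by lra.
rewrite -sqrtr_sqr ler_wsqrtr// /abs2.
have h w : `|w| <= b -> w ^+ 2 <= b ^+ 2.
  by move=> wb; rewrite -(real_normK (num_real w)) lerXn2r ?nnegrE.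
by have := h _ rb; have := h _ ib; have := sqr_ge0 b; lra.
Qed.

Lemma cflat_bounds L (p : R -> R[i]) : 0 < L -> cflat L p ->
  exists2 K, 0 <= K & forall x y, 0 <= x -> x <= y -> y <= L ->
    [/\ `|p y - p x| <= (K * (y - x))%:C%C, `|p y - p 0| <= (K * y ^+ 2)%:C%C &
        `|p L - p x| <= (K * (L - x) ^+ 2)%:C%C].
Proof.
move=> L0 [[a [b /(flat_bounds L0)[K K0 KP]]] [c [d /(flat_bounds L0)[M M0 MP]]]].
exists (2 * (K + M)); first by lra.
move=> x y x0 xy yL; have [r1 r2 r3] := KP x y x0 xy yL; have [i1 i2 i3] := MP x y x0 xy yL.
have cl (z : R[i]) (s : R) : 0 <= s -> `|complex.Re z| <= K * s ->
    `|complex.Im z| <= M * s -> `|z| <= (2 * (K + M) * s)%:C%C.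
  move=> s0 zr zi; rewrite -mulrA; apply: normc_le.
    by rewrite (le_trans zr)// ler_wpM2r// lerDl.
  by rewrite (le_trans zi)// ler_wpM2r// lerDr.
split; apply: cl; rewrite ?raddfB ?sqr_ge0//.
by rewrite subr_ge0.
Qed.

Lemma cvg_quadratic (q : R -> R[i]^o) (L K : R) : 0 < L -> 0 <= K ->
  (forall t, 0 < t -> t <= L -> `|q t| <= (K * t ^+ 2)%:C%C) ->
  (fun t => q t / t%:C%C) @ (0 : R)^'+ --> (0 : R[i]^o).
Proof.
move=> L0 K0 qK; apply/cvgrPdist_lt => _ /gt0_complex[eps er ->].
near=> t.
have t0 : 0 < t by near: t; exact: nbhs_right_gt.
have tL : t <= L by near: t; exact: nbhs_right_le.
have tK : t < eps / (K + 1).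
  by near: t; apply: nbhs_right_lt; rewrite divr_gt0//; lra.
rewrite sub0r normrN normrM normfV.
have -> : `|t%:C%C| = t%:C%C :> R[i] by rewrite ger0_norm// lecR ltW.
rewrite ltr_pdivrMr; last by rewrite ltcR.
rewrite (le_lt_trans (qK t t0 tL))//.
rewrite -rmorphM ltcR expr2 mulrA ltr_pM2r//.
move: tK; rewrite ltr_pdivlMr; last by lra.
lra.
Unshelve. all: by end_near. Qed.

Lemma cflat_lim0 L (p : R -> R[i]^o) : 0 < L -> cflat L p ->
  lim ((fun t : R => (p t - p 0) / t%:C%C) @ (0 : R)^'+) = 0.
Proof.
move=> L0 /(cflat_bounds L0)[K K0 KP]; apply: cvg_lim => //.
apply: (@cvg_quadratic (fun t => p t - p 0) L K) => // t t0 tL.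
by have [] := KP t t (ltW t0) (lexx t) tL.
Qed.

Lemma cflat_limL L (p : R -> R[i]^o) : 0 < L -> cflat L p ->
  lim ((fun t : R => (p (L - t) - p L) / t%:C%C) @ (0 : R)^'+) = 0.
Proof.
move=> L0 /(cflat_bounds L0)[K K0 KP]; apply: cvg_lim => //.
apply: (@cvg_quadratic (fun t => p (L - t) - p L) L K) => // t t0 tL.
have [||_ _] := KP (L - t) (L - t) _ (lexx _).
- by lra.
- by lra.
by rewrite -normrN opprB; have -> : L - (L - t) = t by ring.
Qed.

(** The topology tests continuity on the whole line, where [edge_map] is constant beyond the
    endpoints. Thus [q] is [p] composed with the projection onto [[0, L]], and inherits its
    Lipschitz bound. *)
Lemma cflat_continuous L (p q : R -> R[i]^o) : 0 < L -> cflat L p ->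
  (forall t, t <= 0 -> q t = p 0) -> (forall t, L <= t -> q t = p L) ->
  (forall t, t \in `[0, L] -> q t = p t) -> continuous q.
Proof.
move=> L0 /(cflat_bounds L0)[K K0 KP] q0 qL qp.
have lip x y : x <= y -> `|q y - q x| <= (K * (y - x))%:C%C.
  move=> xy.
  have K0c s : 0 <= s -> (0 : R[i]) <= (K * s)%:C%C by move=> s0; rewrite lecR mulr_ge0.
  pose pr t : R := if t <= 0 then 0 else if L <= t then L else t.
  have qE t : q t = p (pr t).
    rewrite /pr; have [t0|t0] := leP t 0; first exact: q0.
    have [tL|tL] := leP L t; first exact: qL.
    by rewrite qp// in_itv/= !ltW.
  have prI t : 0 <= pr t <= L.
    by rewrite /pr; have [t0|t0] := leP t 0; have [tL|tL] := leP L t; apply/andP; split; lra.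
  have prm : pr x <= pr y /\ pr y - pr x <= y - x.
    by rewrite /pr; clear - xy L0; have [x1|x1] := leP x 0; have [x2|x2] := leP L x;
      have [y1|y1] := leP y 0; have [y2|y2] := leP L y; split; lra.
  have [/andP[px0 _] /andP[_ pyL]] := (prI x, prI y).
  have [h _ _] := KP _ _ px0 prm.1 pyL; rewrite !qE (le_trans h)// lecR.
  by rewrite ler_wpM2l// prm.2.
move=> x; apply/cvgrPdist_lt => _ /gt0_complex[eps er ->].
have lip' y : `|q x - q y| <= (K * `|x - y|)%:C%C.
  have [xy|/ltW yx] := leP x y.
    by rewrite distrC [`|x - y|]ler0_norm ?subr_le0// opprB; exact: lip.
  by rewrite [`|x - y|]ger0_norm ?subr_ge0//; exact: lip.
have eK : 0 < eps / (K + 1) by rewrite divr_gt0//; lra.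
apply/nbhs_ballP; exists (eps / (K + 1)) => //= y xy.
rewrite (le_lt_trans (lip' y))// ltcR.
have : `|x - y| < eps / (K + 1) by [].
rewrite ltr_pdivlMr; last by lra.
by have := normr_ge0 (x - y); lra.
Qed.

Lemma cenergyB_flat L (u p : R -> R[i]) g phi phi' : 0 <= L -> is_wderiv L u g ->
  h1 L (repart p) phi -> h1 L (impart p) phi' ->
  cenergy L (fun x => u x - p x) =
   (h1dist L (repart u) (repart g) (repart p) phi +
    h1dist L (impart u) (impart g) (impart p) phi')%:E.
Proof.
move=> L0 ug pr pi.
have pd : is_wderiv L p (fun x => (phi x +i* phi' x)%C) by apply/is_wderivP.
have d := is_wderivB ug pd.
rewrite (cenergyE (is_wderiv_L2 L0 d) d); congr EFin.
rewrite !h1dist_energy; congr (_ + _); rewrite /energy /repart /impart;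
  by congr (_ + _); apply: eq_Rint => x _; rewrite raddfB.
Qed.

Lemma edge_perturb L (u : R -> R[i]) d : 0 < L -> H1_interval L u -> 0 < d ->
  exists2 r, 0 < r & forall a b : R[i],
    `|complex.Re (u 0) - complex.Re a| <= r -> `|complex.Im (u 0) - complex.Im a| <= r ->
    `|complex.Re (u L) - complex.Re b| <= r -> `|complex.Im (u L) - complex.Im b| <= r ->
  exists p, [/\ cflat L p, p 0 = a, p L = b &
    (cenergy L (fun x => (u x - p x)%R) <= d%:E)%E].
Proof.
move=> L0 uH d0; have ug := wderivP uH; have [ur ui] := (is_wderivP _ _ _).1 ug.
have d2 : 0 < d / 2 by lra.
have [r1 r10 r1P] := flat_perturb L0 ur d2; have [r2 r20 r2P] := flat_perturb L0 ui d2.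
exists (Num.min r1 r2); first by rewrite lt_min r10.
move=> a b; rewrite !le_min => /andP[a1 _] /andP[_ a2] /andP[b1 _] /andP[_ b2].
have [p [phi [psi [fp p0 pL pd]]]] := r1P _ _ a1 b1.
have [q [phi' [psi' [fq q0 qL qd]]]] := r2P _ _ a2 b2.
exists (fun x => (p x +i* q x)%C); split.
- by split; [exists phi, psi|exists phi', psi'].
- by rewrite p0 q0; case: (a).
- by rewrite pL qL; case: (b).
have hp : h1 L p phi by case: fp.
have hq : h1 L q phi' by case: fq.
rewrite (cenergyB_flat (p := fun x => (p x +i* q x)%C) (ltW L0) ug hp hq) lee_fin.
by move: pd qd; rewrite /repart /impart /=; lra.
Qed.

Lemma edge_interpolation L (u : R -> R[i]) (a b : R[i]) : 0 < L -> H1_interval L u ->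
  `|complex.Re a| <= `|complex.Re (u 0)| -> `|complex.Im a| <= `|complex.Im (u 0)| ->
  `|complex.Re b| <= `|complex.Re (u L)| -> `|complex.Im b| <= `|complex.Im (u L)| ->
  `|complex.Re a - complex.Re b| <= `|complex.Re (u 0) - complex.Re (u L)| ->
  `|complex.Im a - complex.Im b| <= `|complex.Im (u 0) - complex.Im (u L)| ->
  exists p, [/\ cflat L p, p 0 = a, p L = b,
    (cenergy L (fun x => (u x - p x)%R) <= 46%:E * cenergy L u)%E &
    a = 0 -> b = 0 -> p = (fun=> 0)].
Proof.
move=> L0 uH a1 a2 b1 b2 ab1 ab2; have ug := wderivP uH; have [ur ui] := (is_wderivP _ _ _).1 ug.
have [p [phi [psi [fp p0 pL pd pz]]]] := flat_interpolation L0 ur a1 b1 ab1.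
have [q [phi' [psi' [fq q0 qL qd qz]]]] := flat_interpolation L0 ui a2 b2 ab2.
exists (fun x => (p x +i* q x)%C); split.
- by split; [exists phi, psi|exists phi', psi'].
- by rewrite p0 q0; case: (a).
- by rewrite pL qL; case: (b).
have hp : h1 L p phi by case: fp.
have hq : h1 L q phi' by case: fq.
  rewrite (cenergyB_flat (p := fun x => (p x +i* q x)%C) (ltW L0) ug hp hq).
  rewrite (cenergyE uH.1 ug) -EFinM lee_fin.
  by move: pd qd; rewrite /repart /impart /=; lra.
by move=> a0 b0; apply/funext => x; rewrite pz ?qz// ?a0 ?b0.
Qed.

(** Functions equal on [[0, L]] have the same set of admissible derivatives, so [wderiv] chooses the
    same element. *)
Lemma cenergy_ext L (u v : R -> R[i]) : 0 <= L -> (forall x, x \in `[0, L] -> u x = v x) ->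
  cenergy L u = cenergy L v.
Proof.
move=> L0 uv; rewrite /cenergy; congr (_ + _)%E.
  by apply: eq_integral => x; rewrite inE /= => /uv ->.
suff -> : wderiv L u = wderiv L v by [].
have I0 : 0 \in `[0, L] by rewrite in_itv/= lexx.
rewrite /wderiv; congr xget; apply/seteqP; split => g [g2 h]; split => // x xL.
  by rewrite -(uv x xL) -(uv 0 I0) h.
by rewrite (uv x xL) (uv 0 I0) h.
Qed.

End FlatFunctions.

(** * Functions vanishing at all ends *)

Section Approximation.
Context {R : realType} {G : metric_graph R}.
Implicit Types (f g : mg_point G -> R[i]^o) (e : edge G) (u v : vert G).

Lemma esum_early_tail (a : edge G -> \bar R) (d : R) : (forall e, 0 <= a e)%E ->
  (\esum_(e in [set: edge G]) a e < +oo)%E -> 0 < d ->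
  exists n, (\esum_(e in ~` early n) a e < d%:E)%E.
Proof.
move=> a0 afin d0; set M := esum _ _ in afin.
have Mfin : M \is a fin_num by rewrite ge0_fin_numE// esum_ge0.
have : (M - d%:E < M)%E by rewrite lteBlDr// lteDl// lte_fin.
move=> /ereal_sup_gt[_ [X [finX _] <-] MX].
have [n Xn] := finite_early finX; exists n.
have Mid : M = (\esum_(e in early n) a e + \esum_(e in ~` early n) a e)%E.
  by rewrite /M (esumID (early n) setT)// !setTI.
have XE : (\sum_(e \in X) a e <= \esum_(e in early n) a e)%E by apply: esum_ge; exists X.
set A := esum (early n) _ in Mid XE; set B := esum (~` early n) _ in Mid *.
have A0 : (0 <= A)%E by apply: esum_ge0.
have B0 : (0 <= B)%E by apply: esum_ge0.
have Afin : A \is a fin_num.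
  rewrite ge0_fin_numE// (le_lt_trans _ afin)// Mid leeDl//.
have := lt_le_trans MX XE; rewrite lteBlDr// Mid => h.
by move: h; rewrite lteD2lE.
Qed.

Lemma le_esumZl (P : set (edge G)) (a : edge G -> \bar R) (k : R) : 0 <= k ->
  (forall e, 0 <= a e)%E ->
  (\esum_(e in P) (k%:E * a e) <= k%:E * \esum_(e in P) a e)%E.
Proof.
move=> k0 a0; apply: ge_ereal_sup => _ [X [finX XP] <-].
rewrite -ge0_mule_fsumr//; apply: lee_wpmul2l; first by rewrite lee_fin.
by apply: esum_ge; exists X.
Qed.

Lemma cvg0_abs2_near (z : nat -> R[i]^o) (d : R) : 0 < d ->
  z @ \oo --> (0 : R[i]^o) -> exists k, abs2 (z k) < d.
Proof.
move=> d0 /cvgrPdist_lt /(_ (Num.sqrt d)%:C%C) [|K _ /(_ K (leqnn K))].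
  by rewrite ltcR sqrtr_gt0.
rewrite sub0r normrN normc_abs2 ltcR ltr_sqrt// => zK; by exists K.
Qed.

Lemma vanishing_finite f d : H1 G f ->
  (forall gamma, topological_ends G gamma -> boundary_value f gamma 0) -> 0 < d ->
  finite_set [set v | d <= abs2 (f (Vertex v))].
Proof.
move=> [_ [_ f2] fH fd2] f0 d0; apply: contrapT => /end_of_infinite[U [x [Uend Ux Ss]]].
have Efin : (\esum_(e in [set: edge G]) edge_energy f e < +oo)%E.
  by rewrite -H1norm_sqE; exact: lte_add_pinfty.
(* One half of [d] for the oscillation on the component, the other for the value at a vertex of the
   ray: together they contradict [d <= abs2] at the vertex [s]. *)
have [n nE] := esum_early_tail (edge_energy_ge0 f) Efin (divr_gt0 d0 (ltr0Sn R 1)).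
have [|om [_ omU] omcvg] := f0 [set U' | end_sequence U' /\ end_equiv U U'].
  by exists U.
have UU : [set U' | end_sequence U' /\ end_equiv U U'] U.
  by split => // k; exists k, k; split; exact: subset_refl.
have [r omr rU] := omU U UU n.
have [k rk] := cvg0_abs2_near (divr_gt0 d0 (ltr0Sn R 1)) (omcvg r omr).
have [s /= ds xs] := Ss n.
have sr : conn (~` early n) s (r k).
  by apply: conn_trans (Ux n _ (rU k)); exact: conn_sym.
have := le_lt_trans (conn_osc fH sr) nE; rewrite lte_fin.
by have := ler_norm (abs2 (f (Vertex s)) - abs2 (f (Vertex (r k)))); lra.
Qed.

(** Soft thresholding of real and imaginary parts. Unlike setting small values to 0, it does not
    increase differences of neighbouring values, as interpolation on short edges requires. *)
Definition shrink (r : R) (z : R[i]) : R[i] :=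
  ((complex.Re z - clamp r (complex.Re z)) +i* (complex.Im z - clamp r (complex.Im z)))%C.

Lemma shrink_contract1 (r x y : R) : 0 <= r ->
  `|(x - clamp r x) - (y - clamp r y)| <= `|x - y|.
Proof.
move=> r0; have := ler_norm (x - y); have := ler_norm (y - x); rewrite distrC ler_norml.
by rewrite !clampE//; do !case: ifPn; rewrite -?leNgt => *; apply/andP; split; lra.
Qed.

Lemma shrink_eq0 (r : R) (z : R[i]) : abs2 z <= r ^+ 2 -> 0 <= r -> shrink r z = 0.
Proof.
move=> zr r0.
have h (w : R) : w ^+ 2 <= r ^+ 2 -> clamp r w = w.
  move=> wr; apply: clamp_id; rewrite -(@ler_pXn2r _ 2)// ?nnegrE//.
  by rewrite real_normK ?num_real.
rewrite /shrink !h ?subrr//.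
- by rewrite (le_trans _ zr)// lerDr sqr_ge0.
- by rewrite (le_trans _ zr)// lerDl sqr_ge0.
Qed.

Definition glue (c : vert G -> R[i]) (P : edge G -> R -> R[i]) : mg_point G -> R[i]^o :=
  fun p => match p with
  | Vertex v => c v
  | Inner e t _ => P e t
  end.

Lemma glue_edge c P e t : P e 0 = c (src e) -> P e (len e) = c (tgt e) ->
  t \in `[0, len e] -> edge_fun (glue c P) e t = P e t.
Proof.
move=> p0 pL; rewrite in_itv/= => /andP[t0 tL]; rewrite /edge_fun.
case: edge_mapP => //= h.
  by have -> : t = 0 by apply/eqP; rewrite eq_le h.
by have -> : t = len e by apply/eqP; rewrite eq_le h tL.
Qed.

Lemma finite_pos_bound (A : set (edge G)) (r : edge G -> R) : finite_set A ->
  (forall e, 0 < r e) -> exists2 d, 0 < d & forall e, A e -> d <= r e.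
Proof.
move=> /finite_seqP[s ->] r0; elim: s => [|e s [d d0 dr]]; first by exists 1.
exists (Num.min (r e) d); first by rewrite lt_min r0.
move=> e' /=; rewrite inE => /predU1P[->|es]; first by rewrite ge_min lexx.
by rewrite ge_min dr ?orbT.
Qed.

Lemma glue_H2_finite c P :
  (forall e, [/\ cflat (len e) (P e), P e 0 = c (src e) & P e (len e) = c (tgt e)]) ->
  (exists2 A, finite_set A & forall e, ~ A e -> P e = (fun=> 0)) ->
  H2_finite_kirchhoff (glue c P).
Proof.
move=> cP [A finA A0]; set g := glue c P.
have gE e t : t \in `[0, len e] -> edge_fun g e t = P e t.
  by have [_ p0 pL] := cP e; exact: glue_edge.
have gE0 e : edge_fun g e 0 = P e 0 by apply: gE; exact: mem0_len.
have gEL e : edge_fun g e (len e) = P e (len e) by apply: gE; exact: mem_len.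
have cfl e : cflat (len e) (edge_fun g e).
  have [fl _ _] := cP e; apply: cflat_ext fl; first exact/ltW/len_gt0.
  by move=> t /gE.
have H2e e : H2_interval (len e) (edge_fun g e) by apply: cflat_H2 (cfl e); exact/ltW/len_gt0.
split => //.
- split; first by move=> e; have [[]] := H2e e.
  have z e : (0 <= L2sq (len e) (edge_fun g e))%E.
    by apply: integral_ge0 => x _; rewrite lee_fin abs2_ge0.
  rewrite /L2norm_sq (esumID A)// setTI setTI [X in (_ + X)%E]esum1; last first.
    move=> e /A0 Pe0; rewrite /L2sq; apply: integral0_eq => x /= xL.
    by rewrite gE// Pe0 /abs2 /= expr0n /= addr0.
  rewrite adde0 esum_fset// fsbig_finite//; apply: lte_sum_pinfty => e _.
  by have [[[]]] := H2e e.
- apply: sub_finite_set finA => e [t tL]; apply: contra_neqP => /A0 Pe0.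
  by rewrite gE// Pe0.
move=> v; split.
  have cg : continuous g.
    apply: mg_continuous => e; have -> : g \o edge_map e = edge_fun g e by [].
    apply: (cflat_continuous (len_gt0 e) (cfl e)) => // t tt.
      by rewrite /edge_fun edge_map_src// edge_map_src.
    by rewrite /edge_fun edge_map_tgt// edge_map_tgt.
  exact: cg.
apply: fsbig1 => e _; rewrite /outer_deriv; case: ifP => _.
  exact: (cflat_lim0 (len_gt0 e) (cfl e)).
exact: (cflat_limL (len_gt0 e) (cfl e)).
Qed.

Lemma boundary_H1_0 f : H1 G f ->
  (forall gamma, topological_ends G gamma -> boundary_value f gamma 0) -> H1_0 G f.
Proof.
move=> f1 f0; split => // eps eps0.
have [_ [_ f2] fH fd2] := f1.
have e20 : 0 < eps ^+ 2 by exact: exprn_gt0.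
have Efin : (\esum_(e in [set: edge G]) edge_energy f e < +oo)%E.
  by rewrite -H1norm_sqE; exact: lte_add_pinfty.
(* The interpolation constant is 46, so the edges outside [early n] contribute at most [46 / 100] of
   [eps ^+ 2], less than half. *)
have [|n nE] := @esum_early_tail _ (eps ^+ 2 / 100) (edge_energy_ge0 f) Efin.
  by rewrite divr_gt0.
pose N := size (finmap.enum_fset (fset_set (@early R G n))).
(* An equal share of the other half for each of the [N] early edges; [N + 1] keeps the divisor
   positive. *)
pose d := eps ^+ 2 / (2 * (N%:R + 1)).
have N0 : (0 : R) <= N%:R by [].
have d0 : 0 < d by rewrite divr_gt0//; lra.
have pert e := edge_perturb (len_gt0 e) (fH e) d0.
pose r0 e := s2val (cid2 (pert e)).
have r00 e : 0 < r0 e := s2valP (cid2 (pert e)).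
have [r rp rr] := finite_pos_bound (early_finite n) r00.
have rge0 := ltW rp.
pose c v := shrink r (f (Vertex v)).
pose S := [set v | r ^+ 2 <= abs2 (f (Vertex v))].
have finS : finite_set S by apply: vanishing_finite => //; exact: exprn_gt0.
have cS v : ~ S v -> c v = 0.
  by move=> /negP; rewrite -ltNge => h; apply: shrink_eq0 => //; exact: ltW.
have Pex e : exists p : R -> R[i], [/\ cflat (len e) p, p 0 = c (src e), p (len e) = c (tgt e),
   early n e -> (cenergy (len e) (fun x => (edge_fun f e x - p x)%R) <= d%:E)%E &
   ~ early n e ->
    (cenergy (len e) (fun x => (edge_fun f e x - p x)%R) <= 46%:E * edge_energy f e)%E /\
     (c (src e) = 0 -> c (tgt e) = 0 -> p = (fun=> 0))].
  have [en|en] := pselect (early n e).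
    have cl v : `|complex.Re (f (Vertex v)) - complex.Re (c v)| <= r0 e /\
        `|complex.Im (f (Vertex v)) - complex.Im (c v)| <= r0 e.
      by rewrite /c /shrink /=; split; rewrite opprB addrC subrK (le_trans (clamp_le _ rge0))// rr.
    have := s2valP' (cid2 (pert e)) (c (src e)) (c (tgt e)).
    rewrite -/(r0 e) edge_fun_src edge_fun_tgt => /(_ (cl _).1 (cl _).2 (cl _).1 (cl _).2).
    by move=> [p [pf p0 pL pE]]; exists p.
  have [] := @edge_interpolation _ _ (edge_fun f e) (c (src e)) (c (tgt e)) (len_gt0 e) (fH e).
  1-6: rewrite ?edge_fun_src ?edge_fun_tgt /c /shrink /=.
  - exact: clampB_le.
  - exact: clampB_le.
  - exact: clampB_le.
  - exact: clampB_le.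
  - exact: shrink_contract1.
  - exact: shrink_contract1.
  by move=> p [pf p0 pL pE pz]; exists p; split.
have [P PP] := choice Pex.
pose g := glue c P.
have gE e t : t \in `[0, len e] -> edge_fun g e t = P e t.
  by have [_ p0 pL _ _] := PP e; exact: glue_edge.
have gH : H2_finite_kirchhoff g.
  apply: glue_H2_finite; first by move=> e; have [] := PP e.
  (* Any other edge has shrunk value 0 at both ends, where the interpolant was chosen to be
     identically 0; local finiteness makes this set finite. *)
  exists (early n `|` \bigcup_(v in S) incident v).
    rewrite finite_setU; split; first exact: early_finite.
    by apply: bigcup_finite => // v _; exact: incident_finite.
  move=> e /not_orP[en eS]; have [_ _ _ _ /(_ en)[_ pz]] := PP e.
  by apply: pz; apply: cS => Sv; apply: eS; eexists; [exact: Sv|left|exact: Sv|right].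
exists g => //.
have EE e : edge_energy (f \- g)%R e = cenergy (len e) (fun x => (edge_fun f e x - P e x)%R).
  apply: cenergy_ext; first exact/ltW/len_gt0.
  by move=> x /gE <-.
rewrite H1norm_sqE (esumID (early n) setT); last by move=> *; exact: edge_energy_ge0.
rewrite !setTI.
have head : (\esum_(e in early n) edge_energy (f \- g)%R e <= (N%:R * d)%:E)%E.
  rewrite esum_fset; [|exact: early_finite|by move=> *; exact: edge_energy_ge0].
  rewrite fsbig_finite; last exact: early_finite.
  have le1 : (\sum_(e <- finmap.enum_fset (fset_set (@early R G n))) edge_energy (f \- g)%R e <=
      \sum_(e <- finmap.enum_fset (fset_set (@early R G n))) d%:E)%E.
    rewrite big_seq [leRHS]big_seq; apply: lee_sum => e.
    rewrite in_fset_set; last exact: early_finite.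
    by rewrite inE => en; rewrite EE; have [_ _ _ /(_ en)] := PP e.
  rewrite (le_trans le1)// sumEFin big_const_seq count_predT iter_addr_0 lee_fin.
  by rewrite mulr_natl.
have tail : (\esum_(e in ~` early n) edge_energy (f \- g)%R e <= (46 * (eps ^+ 2 / 100))%:E)%E.
  apply: (@le_trans _ _ (\esum_(e in ~` early n) (46%:E * edge_energy f e))%E).
    by apply: le_esum => e en; rewrite EE; have [_ _ _ _ /(_ en)[]] := PP e.
  apply: (le_trans (le_esumZl _ _ (edge_energy_ge0 f))) => //.
  by rewrite EFinM; apply: lee_wpmul2l; [rewrite lee_fin|exact: ltW].
apply: (le_lt_trans (leeD head tail)); rewrite -EFinD lte_fin.
have : N%:R * d <= eps ^+ 2 / 2.
  have -> : eps ^+ 2 / 2 = (N%:R + 1) * d by rewrite /d; field; lra.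
  by rewrite ler_pM2r//; lra.
lra.
Qed.

End Approximation.

Theorem theorem3p12 (R : realType) (G : metric_graph R) :
  H1_0 G = [set f | H1 G f /\
    forall gamma, topological_ends G gamma -> boundary_value f gamma 0].
Proof.
apply/seteqP; split => f.
  by move=> f0; split; [case: f0|exact: H1_0_boundary].
by move=> [f1 f0]; exact: boundary_H1_0.
Qed.
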